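(* Let $K$ be a field and let $I\subset K[x,y]$ be a concave monomial ideal of height $2$ with minimal monomial generators $G(I)=\{u_1,\ldots,u_m\}$, where $u_1>u_2>\cdots>u_m$ in the lexicographic order, $u_i=x^{a_i}y^{b_i}$ and $\mathbf{c}_i=(a_i,b_i)$ for $i=1,\ldots,m$. Let $F(I)=K[z_1,\ldots,z_m]/L$ be its fiber cone (with $z_i$ mapping to the class of $u_i$ in $I/\mathfrak m I$), and let $\{\mathbf{c}_{j_1},\ldots,\mathbf{c}_{j_\ell}\}$ with $1=j_1<j_2<\cdots<j_\ell=m$ be the set of corner points of $I$. Then: (a) Let $\mathcal B$ be the set of binomials which is the union of the sets of $2$-minors of the matrices $$M_k=\begin{pmatrix} z_{j_k} & z_{j_k+1} & \cdots & z_{j_{k+1}-1}\\ z_{j_k+1} & z_{j_k+2} & \cdots & z_{j_{k+1}}\end{pmatrix},\qquad k=1,\ldots,\ell-1.$$ Then $\mathcal B\subset L$. (b) Let $<$ be the reverse lexicographic order on $K[z_1,\ldots,z_m]$ induced by $z_1>\cdots>z_m$, and let $\mathcal M$ be the set of monomials $z_iz_j$ with $1<i\le j<m$ such that $z_iz_j\neq \mathrm{in}_<(f)$ for every $f\in\mathcal B$. Then $\mathcal M\subset L$. (c) Let $L_0$ be the ideal generated by the binomials of $\mathcal B$ together with the monomials of $\mathcal M$. Then, with respect to the order $<$ of (b), $\mathrm{in}_<(L_0)=(z_2,\ldots,z_{m-1})^2$. (d) $L_0=L$. (e) $F(I)$ is a Cohen--Macaulay Koszul algebra.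
   Context: $K$ is a field, $\mathfrak m=(x,y)\subset K[x,y]$. For a monomial ideal $I\subset K[x,y]$ of height $2$, $G(I)=\{u_1,\ldots,u_m\}$ is its unique minimal set of monomial generators, labeled so that $u_1>\cdots>u_m$ lexicographically (with $x>y$). Writing $u_i=x^{a_i}y^{b_i}$, one has $a_1>\cdots>a_m=0$ and $0=b_1<\cdots<b_m$ (so $m\ge 2$). The exponent vector of $u_i$ is $\mathbf c_i=(a_i,b_i)$. For integer vectors, $\mathbf a\le\mathbf b$ means componentwise inequality, and $\mathbf a<\mathbf b$ means $\mathbf a\le\mathbf b$ and $\mathbf a\ne\mathbf b$. The ideal $I$ is concave if $2\mathbf c_i\ge \mathbf c_{i-1}+\mathbf c_{i+1}$ for $i=2,\ldots,m-1$. For concave $I$, $\mathbf c_i$ is a corner point of $I$ if $i=1$, or $i=m$, or $2\mathbf c_i>\mathbf c_{i-1}+\mathbf c_{i+1}$. The fiber cone of $I$ is $F(I)=R(I)/\mathfrak mR(I)=\bigoplus_{k\ge0}I^k/\mathfrak mI^k$, where $R(I)=\bigoplus_{k\ge 0}I^k$ is the Rees ring. $L$ is the kernel of the surjective $K$-algebra homomorphism $K[z_1,\ldots,z_m]\to F(I)$ sending $z_i$ to the residue class of $u_i$ in $F(I)_1=I/\mathfrak mI$. The reverse lexicographic order is the graded reverse lexicographic order; $\mathrm{in}_<(f)$ denotes the initial monomial of $f$ (without coefficient) and $\mathrm{in}_<(L_0)$ the initial ideal. A standard graded $K$-algebra is Koszul if its residue field $K$ has a linear free resolution over it. *)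

(* Defs.v *)
From HB Require Import structures.
From mathcomp Require Import all_boot all_order all_algebra.
From mathcomp Require Import generic_quotient ring_quotient.
From mathcomp Require Import mpoly.
From mathcomp Require Import boolp classical_sets.

Set Implicit Arguments.
Unset Strict Implicit.
Unset Printing Implicit Defensive.

Import GRing.Theory.

Local Open Scope ring_scope.
Local Open Scope quotient_scope.
Local Open Scope classical_set_scope.

Section Ideals.
Context {A : comNzRingType}.
Implicit Types (I J P S : set A) (s : seq A).

(* The unit ideal is allowed, unlike in [idealr_closed]. *)
Definition is_ideal I : Prop :=
  I 0 /\ forall a u v, I u -> I v -> I (a * u + v).

Definition ideal_gen S : set A := smallest is_ideal S.

Fixpoint ideal_pow I (k : nat) : set A :=
  if k is k'.+1
  then ideal_gen [set a * b | a in ideal_pow I k' & b in I]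
  else setT.

Definition prime_ideal P : Prop :=
  [/\ is_ideal P, ~ P 1 & forall a b, P (a * b) -> P a \/ P b].

Definition maximal_ideal P : Prop :=
  [/\ is_ideal P, ~ P 1
    & forall J, is_ideal J -> P `<=` J -> ~ J 1 -> J = P].

Definition noetherian : Prop :=
  forall I, is_ideal I -> exists s, I = ideal_gen [set` s].

(* [P] is the top of a chain of primes Q 0 < Q 1 < ... < Q n = P. *)
Definition prime_height_ge P (n : nat) : Prop :=
  exists Q : nat -> set A,
    [/\ forall i, (i <= n)%N -> prime_ideal (Q i),
        forall i, (i < n)%N -> Q i `<` Q i.+1
      & Q n = P].

(* The height of a proper ideal is the minimum of the heights of the primes
   containing it. No number is a height of the unit ideal. *)
Definition height I (n : nat) : Prop :=
  (forall P, prime_ideal P -> I `<=` P -> prime_height_ge P n) /\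
  (exists P, [/\ prime_ideal P, I `<=` P & ~ prime_height_ge P n.+1]).

Definition regular_sequence s : Prop :=
  (forall i, (i < size s)%N -> forall a,
     ideal_gen [set` take i s] (s`_i * a) -> ideal_gen [set` take i s] a) /\
  ~ ideal_gen [set` s] 1.

(* The maximal length of a regular sequence contained in [I]. *)
Definition depth I (n : nat) : Prop :=
  (exists s, [/\ regular_sequence s, [set` s] `<=` I & size s = n]) /\
  (forall s, regular_sequence s -> [set` s] `<=` I -> (size s <= n)%N).

End Ideals.

(* depth (P, A) is the depth of the local ring A_P and the height of P is its
   dimension (for P maximal), so no localization is needed; this is the
   definition of Eisenbud, Commutative Algebra, Section 18.2. *)
Definition cohen_macaulay (A : comNzRingType) : Prop :=
  @noetherian A /\
  forall P : set A, maximal_ideal P -> exists n, depth P n /\ height P n.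

Section Graded.
Context {K : fieldType} {A : comNzRingType}.
(* [iota] is the structure map and [gr k] the component of degree [k]. *)
Variables (iota : {rmorphism K -> A}) (gr : nat -> set A).

Definition graded_algebra : Prop :=
  [/\ gr 0 = range iota,
      forall k, gr k 0 /\ forall a b, gr k a -> gr k b -> gr k (a - b),
      forall i j a b, gr i a -> gr j b -> gr (i + j)%N (a * b),
      forall a, exists n (f : nat -> A),
        (forall k, gr k (f k)) /\ a = \sum_(k < n) f k
    & forall n (f : nat -> A), (forall k, gr k (f k)) ->
        \sum_(k < n) f k = 0 -> forall k, (k < n)%N -> f k = 0].

Definition standard_graded : Prop :=
  graded_algebra /\
  exists n (g : 'I_n -> A),
    (forall i, gr 1%N (g i)) /\
    (forall a, exists p : {mpoly K[n]}, a = mmap iota g p).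

Definition irrelevant_ideal : set A :=
  ideal_gen [set a | exists2 k, (0 < k)%N & gr k a].

Definition resolution_rank (b : nat -> nat) (i : nat) : nat :=
  if i is i'.+1 then b i' else 1%N.

(* A graded free resolution
     ... -> A(-2)^(b 1) -> A(-1)^(b 0) -> A -> A / A_+ = K -> 0
   of the residue field. The differentials are homogeneous of degree 0, i.e.,
   given by matrices with entries in A_1, acting here on row vectors. *)
Definition linear_resolution_of_residue_field (b : nat -> nat)
    (d : forall i, 'M[A]_(resolution_rank b i.+1, resolution_rank b i)) :
    Prop :=
  [/\ forall i r s, gr 1%N (d i r s),
      forall v : 'rV[A]_(resolution_rank b 0),
        irrelevant_ideal (v ord0 ord0) <-> exists w, v = w *m d 0%N
    & forall i (v : 'rV[A]_(resolution_rank b i.+1)),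
        v *m d i = 0 <-> exists w, v = w *m d i.+1].

Definition koszul : Prop :=
  standard_graded /\ exists b d, @linear_resolution_of_residue_field b d.

End Graded.

Section Monomials.
Context {n : nat}.
Implicit Types u v : 'X_{1..n}.

Definition mnm_lt u v : bool := (u <= v)%MM && (u != v).

(* pure lexicographic order, the variable of index 0 being the largest *)
Definition lex_lt u v : bool :=
  [exists i, (u i < v i)%N && [forall j : 'I_n, (j < i)%N ==> (u j == v j)]].

(* graded reverse lexicographic order, the variable of index 0 being the
   largest; the order on 'X_{1..n} provided by mpoly.v is degree-lexicographic
   (in spite of its documentation) *)
Definition grevlex_lt u v : bool :=
  (mdeg u < mdeg v)%N ||
  (mdeg u == mdeg v) &&
  [exists i, (v i < u i)%N && [forall j : 'I_n, (i < j)%N ==> (u j == v j)]].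

Context {R : comNzRingType}.

Definition initial_monomial (lt : rel 'X_{1..n}) (f : {mpoly R[n]}) u : Prop :=
  u \in msupp f /\ forall v, v \in msupp f -> v != u -> lt v u.

Definition initial_ideal (lt : rel 'X_{1..n}) (J : set {mpoly R[n]}) :
    set {mpoly R[n]} :=
  ideal_gen [set f | exists u, f = 'X_[u] /\
                     exists2 g, J g & initial_monomial lt g u].

Definition minimal_monomial_generators (I : set {mpoly R[n]})
    (G : set 'X_{1..n}) : Prop :=
  I = ideal_gen [set 'X_[u] | u in G] /\
  forall G' : set 'X_{1..n}, G' `<=` G ->
    I = ideal_gen [set 'X_[u] | u in G'] -> G' = G.

End Monomials.

Section IdealFacts.
Context {A : comNzRingType}.
Implicit Types I J S : set A.

Lemma ideal_gen_ideal S : is_ideal (ideal_gen S).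
Proof.
split; first by move=> J [[J0 _] _].
move=> a u v Su Sv J HJ; have [[_ h] _] := HJ.
by apply: h; [exact: Su | exact: Sv].
Qed.

Lemma sub_ideal_gen S : S `<=` ideal_gen S.
Proof. by move=> x Sx J [_]; apply. Qed.

Lemma ideal_gen_min S J : is_ideal J -> S `<=` J -> ideal_gen S `<=` J.
Proof. by move=> HJ SJ x; apply. Qed.

Lemma is_ideal0 J : is_ideal J -> J 0.
Proof. by case. Qed.

Lemma is_idealMl J a u : is_ideal J -> J u -> J (a * u).
Proof. by case=> J0 h Ju; rewrite -[_ * _]addr0; apply: h. Qed.

Lemma is_idealD J u v : is_ideal J -> J u -> J v -> J (u + v).
Proof. by case=> _ h Ju Jv; rewrite -[u]mul1r; apply: h. Qed.

Lemma is_idealB J u v : is_ideal J -> J u -> J v -> J (u - v).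
Proof.
by move=> HJ Ju Jv; apply: is_idealD => //; rewrite -mulN1r; apply: is_idealMl.
Qed.

Lemma is_ideal_sum J (T : Type) (r : seq T) (F : T -> A) :
  is_ideal J -> (forall i, J (F i)) -> J (\sum_(i <- r) F i).
Proof.
move=> HJ JF; elim/big_ind: _ => //; first exact: is_ideal0.
by move=> u v; apply: is_idealD.
Qed.

Lemma ideal_pow_ideal I k : is_ideal (ideal_pow I k).
Proof. by case: k => [|k] /=; [split | exact: ideal_gen_ideal]. Qed.

Lemma ideal_powM I i j a b :
  ideal_pow I i a -> ideal_pow I j b -> ideal_pow I (i + j) (a * b).
Proof.
move=> Ia; elim: j b => [|j IHj] b.
  by move=> _; rewrite addn0 mulrC; apply: is_idealMl; first exact: ideal_pow_ideal.
move: b; rewrite addnS.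
apply: (@ideal_gen_min _ [set b | ideal_pow I (i + j).+1 (a * b)]).
  have Hid := ideal_pow_ideal I (i + j).+1.
  split; first by rewrite /mkset mulr0; exact: is_ideal0.
  move=> r u v; rewrite /mkset => Iu Iv; rewrite mulrDr mulrCA.
  exact: (is_idealD Hid (is_idealMl r Hid Iu) Iv).
move=> _ [u Iu [v Iv <-]] /=; rewrite mulrA; apply: sub_ideal_gen.
by exists (a * u); [exact: IHj | exists v].
Qed.

End IdealFacts.

Section Rees.
Context {A : comNzRingType}.
Variable I : set A.

(* R(I) is the subring of the polynomials sum_k a_k t^k of A[t] with a_k in
   I^k. *)
Definition rees_pred : {pred {poly A}} :=
  fun p => `[< forall k, ideal_pow I k p`_k >].

Lemma rees_pred_subring : subring_closed rees_pred.
Proof.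
split.
- apply/asboolP => -[|k] //; rewrite coefC /=.
  exact: (is_ideal0 (ideal_pow_ideal I k.+1)).
- move=> p q /asboolP Hp /asboolP Hq; apply/asboolP => k; rewrite coefB.
  exact: is_idealB (ideal_pow_ideal I k) (Hp k) (Hq k).
- move=> p q /asboolP Hp /asboolP Hq; apply/asboolP => k; rewrite coefM.
  apply: is_ideal_sum; first exact: ideal_pow_ideal.
  move=> i; have ik : (i + (k - i))%N = k by rewrite subnKC // -ltnS.
  by have := ideal_powM (Hp i) (Hq (k - i)%N); rewrite ik.
Qed.

HB.instance Definition _ :=
  GRing.isSubringClosed.Build {poly A} rees_pred rees_pred_subring.

Record rees : Type := Rees { rees_val : {poly A}; _ : rees_val \in rees_pred }.

HB.instance Definition _ := [isSub for rees_val].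
HB.instance Definition _ := [Choice of rees by <:].
HB.instance Definition _ := [SubChoice_isSubComNzRing of rees by <:].

Lemma rees_const_subproof (a : A) : a%:P \in rees_pred.
Proof.
apply/asboolP => -[|k] //; rewrite coefC /=.
exact: (is_ideal0 (ideal_pow_ideal I k.+1)).
Qed.

Definition rees_const (a : A) : rees := Rees (rees_const_subproof a).

Lemma rees_const_is_zmod_morphism : zmod_morphism rees_const.
Proof. by move=> a b; apply: val_inj; rewrite /= raddfB. Qed.

Lemma rees_const_is_monoid_morphism : monoid_morphism rees_const.
Proof. by split=> [|a b]; apply: val_inj => //=; rewrite polyCM. Qed.

HB.instance Definition _ :=
  GRing.isZmodMorphism.Build A rees rees_const rees_const_is_zmod_morphism.
HB.instance Definition _ :=
  GRing.isMonoidMorphism.Build A rees rees_const rees_const_is_monoid_morphism.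

(* The element u t of R(I), for u in I (and 0 for u outside I). *)
Definition rees_deg1 (u : A) : rees := insubd (0 : rees) (u *: 'X).

End Rees.

Section FiberCone.
Context {K : fieldType} {n : nat}.

Definition max_ideal : set {mpoly K[n]} := ideal_gen [set 'X_i | i in setT].

Variable I : set {mpoly K[n]}.

Definition max_ideal_rees : set (rees I) :=
  ideal_gen [set rees_const I a | a in max_ideal].

Definition fiber_pred : {pred rees I} := fun p => `[< max_ideal_rees p >].

Lemma max_ideal_proper : ~ max_ideal 1.
Proof.
move=> h.
suff : max_ideal `<=` [set f | f.@[fun=> 0] = 0].
  by move=> /(_ _ h) /=; rewrite meval1; apply/eqP; exact: oner_neq0.
apply: ideal_gen_min; first split=> /=; first by rewrite meval0.
  by move=> a u v; rewrite mevalD mevalM => -> ->; rewrite mulr0 addr0.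
by move=> _ [i _ <-] /=; rewrite mevalXU.
Qed.

Lemma fiber_pred_idealr : idealr_closed fiber_pred.
Proof.
have Hid := ideal_gen_ideal [set rees_const I a | a in max_ideal].
split; first by apply/asboolP; exact: (is_ideal0 Hid).
  apply/negP => /asboolP h; apply: max_ideal_proper.
  suff : max_ideal_rees `<=` [set p | max_ideal (rees_val p)`_0].
    by move=> /(_ _ h) /=; rewrite coefC.
  have Hm := ideal_gen_ideal [set ('X_i : {mpoly K[n]}) | i in setT].
  apply: ideal_gen_min; first split=> /=; first by rewrite coef0; exact: (is_ideal0 Hm).
    move=> a u v Hu Hv; rewrite coefD coefM big_ord1.
    exact: (is_idealD Hm (is_idealMl _ Hm Hu) Hv).
  by move=> _ [a Ha <-] /=; rewrite coefC.
move=> a u v /asboolP Hu /asboolP Hv; apply/asboolP.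
exact: (is_idealD Hid (is_idealMl _ Hid Hu) Hv).
Qed.

HB.instance Definition _ :=
  isIdealr.Build (rees I) fiber_pred fiber_pred_idealr.

Definition fiber_cone : Type := {ideal_quot fiber_pred}.

HB.instance Definition _ := GRing.ComNzRing.on fiber_cone.

Definition rees_to_fiber (p : rees I) : fiber_cone :=
  \pi_({ideal_quot fiber_pred}) p.

Lemma rees_to_fiber_is_zmod_morphism : zmod_morphism rees_to_fiber.
Proof. by move=> a b; exact: (raddfB (\pi_({ideal_quot fiber_pred}))). Qed.

Lemma rees_to_fiber_is_monoid_morphism : monoid_morphism rees_to_fiber.
Proof.
by split=> [|a b]; [exact: (rmorph1 (\pi_({ideal_quot fiber_pred})))
                   |exact: (rmorphM (\pi_({ideal_quot fiber_pred})))].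
Qed.

HB.instance Definition _ := GRing.isZmodMorphism.Build (rees I) fiber_cone
  rees_to_fiber rees_to_fiber_is_zmod_morphism.
HB.instance Definition _ := GRing.isMonoidMorphism.Build (rees I) fiber_cone
  rees_to_fiber rees_to_fiber_is_monoid_morphism.

Definition fiber_const : {rmorphism K -> fiber_cone} :=
  rees_to_fiber \o (rees_const I \o mpolyC n (R := K)).

(* F(I)_k = I^k / m I^k, the classes of the elements a t^k of R(I) *)
Definition fiber_degree (k : nat) : set fiber_cone :=
  [set rees_to_fiber p | p in [set p | forall i, i <> k -> (rees_val p)`_i = 0]].

(* The kernel of K[z_1, ..., z_m] -> F(I), where z_i is mapped to the class of
   x^(c i) in F(I)_1 = I / m I. *)
Definition fiber_relations (m : nat) (c : 'I_m -> 'X_{1..n}) :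
    set {mpoly K[m]} :=
  [set f | mmap fiber_const
             (fun i => rees_to_fiber (rees_deg1 I 'X_[c i])) f = 0].

End FiberCone.

Arguments fiber_degree {K n} I k.

(* The indices 1, ..., m of the generators are shifted to 0, ..., m - 1. *)

Section Concave.
Context {m : nat}.
Implicit Type c : 'I_m -> 'X_{1..2}.

Definition concave c : Prop :=
  forall h i k : 'I_m, i = h.+1 :> nat -> k = i.+1 :> nat ->
    (c h + c k <= c i *+ 2)%MM.

Definition corner c (i : 'I_m) : Prop :=
  [\/ i = 0%N :> nat, i.+1 = m
    | exists h k : 'I_m, [/\ i = h.+1 :> nat, k = i.+1 :> nat
                           & mnm_lt (c h + c k)%MM (c i *+ 2)%MM]].

End Concave.

Definition minor (R : comNzRingType) (r p q : nat) (M : 'M[R]_(p, q)) : set R :=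
  [set f | exists (g : 'I_r -> 'I_p) (h : 'I_r -> 'I_q),
     [/\ {homo g : x y / (x < y)%N}, {homo h : x y / (x < y)%N}
       & f = \det (mxsub g h M)]].

Section Relations.
Context {K : fieldType} {m : nat}.

(* The default value is never used in the matrices below. *)
Definition zvar (i : nat) : {mpoly K[m]} :=
  if insub i is Some i' then 'X_(i' : 'I_m) else 0.

(* (z_a     z_(a+1)  ...  z_(b-1))
   (z_(a+1) z_(a+2)  ...  z_b    ) *)
Definition hankel_block (a b : nat) : 'M[{mpoly K[m]}]_(2, b - a) :=
  \matrix_(r, t) zvar (a + r + t).

Definition binomial_relations (l : nat) (j : 'I_l -> 'I_m) :
    set {mpoly K[m]} :=
  [set f | exists k k' : 'I_l,
     k' = k.+1 :> nat /\ minor 2 (hankel_block (j k) (j k')) f].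

Definition monomial_relations (B : set {mpoly K[m]}) : set {mpoly K[m]} :=
  [set f | exists i i' : 'I_m,
     [/\ (0 < i)%N, (i <= i')%N, (i'.+1 < m)%N,
         f = 'X_i * 'X_i'
       & forall g, B g -> ~ initial_monomial grevlex_lt g (U_(i) + U_(i'))%MM]].

(* (z_2, ..., z_(m-1)) in the numbering from 1 *)
Definition inner_variables_ideal : set {mpoly K[m]} :=
  ideal_gen [set 'X_i | i in [set i : 'I_m | (0 < i)%N && (i.+1 < m)%N]].

End Relations.

(* Main.v *)
Require Import Defs.
From mathcomp Require Import all_boot all_algebra.
From mathcomp Require Import perm generic_quotient.
From mathcomp Require Import mpoly ring zify.
From mathcomp Require Import boolp classical_sets.

(** Write [s], [t] for the classes of the first and the last generator and call
    the other variables inner. Concavity bounds [c_i + c_k] below by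
    [c_(i-1) + c_(k+1)] for inner [i <= k], strictly if and only if a corner
    lies in [[i, k]]. Hence [z_i z_k] is [z_(i-1) z_(k+1)] in the fiber cone
    without such a corner and 0 otherwise, and iterating this rewriting step
    reduces every monomial, modulo the binomials and monomials of the theorem,
    to 0 or to a smaller standard monomial, i.e., one divisible by at most one
    inner variable (counted with multiplicity). The exponent vectors of the
    standard monomials of a given degree form an antichain, so their classes
    are linearly independent. This gives the relations and the initial ideal,
    and shows that the fiber cone [A] is free over [K[s, t]] with basis 1 and
    the inner variables.

    Cohen-Macaulayness: a maximal ideal [P] contains nonzero elements of [K[s]]
    and of [K[t]] (a form of Zariski's lemma), which form a regular sequence by
    freeness. A regular sequence of length [r] in a prime yields a chain of
    primes of length [r] below it, and no chain has length 3 because any three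
    elements of [A] are algebraically dependent, the Hilbert function of [A]
    being linear. Hence the depth and the height of [P] are both 2.

    Koszulness: the ideals generated by the initial segments of the sequence
    [s, t, z_2, ..., z_(m-1)] form a Koszul filtration, the successive colon
    ideals being [0], [(s)] and then always the maximal ideal. *)

Set Implicit Arguments.
Unset Strict Implicit.
Unset Printing Implicit Defensive.

Import GRing.Theory.

Local Open Scope ring_scope.
Local Open Scope classical_set_scope.

(** * Primes and regular sequences *)

Section IdealTheory.
Context {A : comNzRingType}.
Implicit Types (I J P Q S : set A) (s : seq A).

Lemma is_idealN J u : is_ideal J -> J u -> J (- u).
Proof. by move=> HJ Ju; rewrite -mulN1r; apply: is_idealMl. Qed.

Lemma is_idealMr J a u : is_ideal J -> J u -> J (u * a).
Proof. by move=> HJ Ju; rewrite mulrC; apply: is_idealMl. Qed.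

Lemma is_ideal_sum_in J (T : Type) (r : seq T) (p : pred T) (F : T -> A) :
  is_ideal J -> (forall i, p i -> J (F i)) -> J (\sum_(i <- r | p i) F i).
Proof.
move=> HJ JF; elim/big_ind: _ => //; first exact: is_ideal0.
by move=> u v; apply: is_idealD.
Qed.

Lemma is_ideal_shift J u v : is_ideal J -> J (u - v) -> J v -> J u.
Proof. by move=> HJ Juv Jv; rewrite -[u](subrK v); apply: is_idealD. Qed.

Lemma is_ideal_zero : is_ideal [set (0 : A)].
Proof. by split=> // a u v /= -> ->; rewrite mulr0 addr0. Qed.

Lemma ideal_genS S T : S `<=` T -> ideal_gen S `<=` ideal_gen T.
Proof.
move=> ST; apply: ideal_gen_min; first exact: ideal_gen_ideal.
exact: subset_trans ST (@sub_ideal_gen _ T).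
Qed.

Lemma ideal_gen_nil (a : A) : ideal_gen [set` [::]] a -> a = 0.
Proof. by apply: (@ideal_gen_min _ _ [set 0]); first exact: is_ideal_zero. Qed.

Lemma ideal_gen_cons (x : A) s a :
  ideal_gen [set` x :: s] a <-> exists b, ideal_gen [set` s] (a - b * x).
Proof.
have Hs := ideal_gen_ideal [set` s]; split.
  apply: (@ideal_gen_min _ _ [set a | exists b, ideal_gen [set` s] (a - b * x)]).
    split; first by exists 0; rewrite mul0r subr0; exact: is_ideal0.
    move=> a0 u v [b Hu] [b' Hv]; exists (a0 * b + b').
    have -> : a0 * u + v - (a0 * b + b') * x =
      a0 * (u - b * x) + (v - b' * x) by ring.
    by case: Hs => _; apply.
  move=> y /=; rewrite inE => /orP[/eqP ->|ys].
    by exists 1; rewrite mul1r subrr; exact: is_ideal0.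
  by exists 0; rewrite mul0r subr0; exact: sub_ideal_gen.
move=> [b Hb]; have Hx := ideal_gen_ideal [set` x :: s].
apply: (is_ideal_shift Hx (v := b * x)).
  by apply: ideal_genS Hb => y /= ys; rewrite inE ys orbT.
by apply: (is_idealMl _ Hx); apply: sub_ideal_gen; rewrite /= mem_head.
Qed.

(** By maximality the ideal [J] generated by [P] and [a] contains 1. *)
Lemma maximal_ideal_inv P a : maximal_ideal P -> ~ P a ->
  exists b, P (b * a - 1).
Proof.
case=> HP P1 Pmax Pa.
pose J : set A := [set u | exists b, P (u - b * a)].
have HJ : is_ideal J.
  split; first by exists 0; rewrite mul0r subr0; exact: is_ideal0.
  move=> a0 u v [b Hu] [b' Hv]; exists (a0 * b + b').
  have -> : a0 * u + v - (a0 * b + b') * a =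
    a0 * (u - b * a) + (v - b' * a) by ring.
  by case: HP => _; apply.
have PJ : P `<=` J by move=> u Pu; exists 0; rewrite mul0r subr0.
have [[b Hb]|J1] := pselect (J 1).
  by exists b; rewrite -opprB; apply: is_idealN.
case: Pa; rewrite -(Pmax J HJ PJ J1); exists 1.
by rewrite mul1r subrr; exact: is_ideal0.
Qed.

Lemma maximal_ideal_prime P : maximal_ideal P -> prime_ideal P.
Proof.
move=> mP; have [HP P1 _] := mP; split=> // a b Pab.
have [|/(maximal_ideal_inv mP)[c Hc]] := pselect (P a); first by left.
right; have -> : b = c * (a * b) - b * (c * a - 1) by ring.
by apply: is_idealB => //; exact: is_idealMl.
Qed.

(* An ideal that is maximal among those containing J and avoiding the
   multiplicative set [x ^+ n * u], u \notin P, is prime. *)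
Lemma prime_below J P x : is_ideal J -> prime_ideal P -> J `<=` P ->
  (forall a, J (x * a) -> J a) ->
  exists Q, [/\ prime_ideal Q, J `<=` Q, Q `<=` P & ~ Q x].
Proof.
move=> HJ [HP P1 PM] JP xreg.
pose S a := exists k u, ~ P u /\ a = x ^+ k * u.
have SM a b : S a -> S b -> S (a * b).
  move=> [k [u [Pu ->]]] [k' [u' [Pu' ->]]].
  exists (k + k')%N, (u * u'); split; first by move=> /PM[].
  by rewrite exprD; ring.
have JS a : J a -> ~ S a.
  move=> + [k [u [Pu ea]]]; rewrite {}ea; elim: k => [|k IH].
    by rewrite expr0 mul1r => /JP.
  by rewrite exprS -mulrA => /xreg.
pose F Q := Q = set0 \/ [/\ is_ideal Q, J `<=` Q & forall a, Q a -> ~ S a].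
have [|Q [FQ Qmax]] := @Zorn_bigcup A F.
  move=> C CF Ctot; have [[X [CX X0]]|C0] := pselect (exists X, C X /\ X !=set0).
    have CD Y a : C Y -> Y a ->
        [/\ is_ideal Y, J `<=` Y & forall a, Y a -> ~ S a].
      by by move=> CY Ya; case: (CF _ CY) => // Y0; move: Ya; rewrite Y0.
    case: X0 => a0 Xa0; have [[X0 _] JX _] := CD _ _ CX Xa0.
    right; split.
    - split; first by exists X.
      move=> a u v [Y CY Yu] [Z CZ Zv].
      have [YZ|ZY] := Ctot _ _ CY CZ.
        exists Z => //; have [[_ HZ] _ _] := CD _ _ CZ Zv.
        by apply: HZ => //; apply: YZ.
      exists Y => //; have [[_ HY] _ _] := CD _ _ CY Yu.
      by apply: HY => //; apply: ZY.
    - by move=> a /JX Xa; exists X.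
    - by move=> a [Y CY Ya]; have [_ _] := CD _ _ CY Ya; apply.
  left; apply/seteqP; split=> // a [Y CY Ya].
  by case: C0; exists Y; split=> //; exists a.
(* A maximal member is not empty, since [J] would be a larger one. *)
have [HQ JQ QS] : [/\ is_ideal Q, J `<=` Q & forall a, Q a -> ~ S a].
  case: FQ => // Q0; case: (Qmax J); last by right; split.
  split; first by rewrite Q0.
  by move=> /(_ 0 (is_ideal0 HJ)); rewrite Q0.
have QP : Q `<=` P.
  move=> a Qa; apply: contrapT => Pa; apply: (QS _ Qa).
  by exists 0%N, a; rewrite mul1r.
have ext a : ~ Q a -> exists2 b, S b & exists r, Q (b - r * a).
  move=> Qa; pose Q' : set A := [set u | exists r, Q (u - r * a)].
  have QQ' : Q `<` Q'.
    split; first by move=> u Qu; exists 0; rewrite mul0r subr0.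
    move=> Q'Q; apply: Qa; apply: Q'Q; exists 1.
    by rewrite mul1r subrr; exact: is_ideal0.
  apply: contrapT => nex; apply: (Qmax _ QQ'); right; split.
  - split; first by exists 0; rewrite mul0r subr0; exact: is_ideal0.
    move=> a0 u v [b Hu] [b' Hv]; exists (a0 * b + b').
    have -> : a0 * u + v - (a0 * b + b') * a =
      a0 * (u - b * a) + (v - b' * a) by ring.
    by case: HQ => _; apply.
  - by move=> u /JQ Qu; exists 0; rewrite mul0r subr0.
  - by move=> b [r Qr] Sb; apply: nex; exists b => //; exists r.
exists Q; split=> //; last first.
  by move=> Qx; apply: (QS _ Qx); exists 1%N, 1; rewrite expr1 mulr1.
split=> //; first by move=> /QP.
(* If neither factor lies in [Q], multiples of them are congruent modulo [Q] to elements [u] and [v]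
   of [S]; then [u * v] lies both in [Q] and in [S]. *)
move=> a b Qab; apply: contrapT => /not_orP[/ext[u Su [r Qu]] /ext[v Sv [q Qv]]].
apply: (QS _ _ (SM _ _ Su Sv)).
have -> : u * v = v * (u - r * a) + (r * a) * (v - q * b) + r * q * (a * b).
  by ring.
by do !apply: is_idealD => //; apply: is_idealMl.
Qed.

(** Induction from the end of the sequence: the last element [x] is regular modulo the others, so
    [prime_below] gives a prime inside [P] that contains the others but not [x]. The chain ending in
    this prime is extended by [P]. *)
Lemma regular_sequence_height s P : regular_sequence s -> prime_ideal P ->
  [set` s] `<=` P -> prime_height_ge P (size s).
Proof.
case=> sreg _; move: s sreg P; apply: last_ind => [|s x IHs] sreg P pP sP.
  by exists (fun=> P); split=> // i; rewrite ltn0.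
have sPs : [set` s] `<=` P.
  by move=> y /= ys; apply: sP; rewrite /= mem_rcons inE ys orbT.
have [||||Q [pQ sQ QP Qx]] := @prime_below (ideal_gen [set` s]) P x.
- exact: ideal_gen_ideal.
- exact: pP.
- by apply: ideal_gen_min => //; case: pP.
- move=> a; have := sreg (size s); rewrite size_rcons ltnSn nth_rcons ltnn eqxx.
  by rewrite -cats1 take_size_cat //; apply.
have Px : P x by apply: sP; rewrite /= mem_rcons mem_head.
have [||C [C1 C2 C3]] := IHs _ Q pQ.
- move=> i lti a; have := sreg i; rewrite size_rcons nth_rcons lti ltnS ltnW //.
  by rewrite -cats1 takel_cat 1?ltnW //; apply.
- by move=> y ys; apply: sQ; apply: sub_ideal_gen.
rewrite size_rcons; exists (fun i => if (i <= size s)%N then C i else P).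
split; last by rewrite ltnn.
- by move=> i; case: ifP => // /C1.
- move=> i /=; rewrite ltnS => lei; have [lti|gei|->] := ltngtP i (size s).
  - by apply: C2.
  - by rewrite leqNgt gei in lei.
  - by rewrite C3; split=> // PQ; apply: Qx; apply: PQ.
Qed.

Lemma prime_height_geW P n n' : (n' <= n)%N ->
  prime_height_ge P n -> prime_height_ge P n'.
Proof.
move=> len [Q [Q1 Q2 Q3]]; exists (fun i => Q (i + (n - n'))%N); split.
- by move=> i lei; apply: Q1; lia.
- by move=> i lti; rewrite addSn; apply: Q2; lia.
- by rewrite subnKC.
Qed.

(** Regular sequences are no longer than chains of primes, so the bound [n] on chains also bounds
    the depth, and the given sequence attains both. The only prime containing a maximal ideal is the
    ideal itself. *)
Lemma cohen_macaulay_criterion (n : nat) :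
  @noetherian A ->
  (forall P, prime_ideal P -> ~ prime_height_ge P n.+1) ->
  (forall P, maximal_ideal P ->
    exists s, [/\ regular_sequence s, [set` s] `<=` P & size s = n]) ->
  cohen_macaulay A.
Proof.
move=> noethA dimA regA; split=> // P mP; exists n.
have pP := maximal_ideal_prime mP.
have [s [sreg sP sn]] := regA P mP.
split; [split; first by exists s|split].
- move=> s' s'reg s'P; rewrite leqNgt; apply/negP => lts.
  by apply: (dimA P pP); apply: (prime_height_geW lts); exact: regular_sequence_height.
- move=> P' [HP' P'1 P'M] PP'; rewrite -sn; have [_ _ Pmax] := mP.
  by rewrite (Pmax P') //; exact: regular_sequence_height.
- by exists P; split=> //; apply: dimA.
Qed.

End IdealTheory.

(** * Noetherian rings *)

Section Noetherian.

Lemma field_noetherian (K : fieldType) : @noetherian K.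
Proof.
move=> I HI; have [[a [Ia a0]]|I0] := pselect (exists a, I a /\ a != 0).
  exists [:: 1]; apply/seteqP; split=> b.
    move=> _; rewrite -[b]mulr1; apply: (is_idealMl _ (ideal_gen_ideal _)).
    by apply: sub_ideal_gen; rewrite /= mem_head.
  apply: ideal_gen_min => // c; rewrite /= inE => /eqP ->.
  by rewrite -(mulVf a0); exact: is_idealMl.
exists [::]; apply/seteqP; split=> b.
  move=> Ib; have -> : b = 0 by apply: contrapT => /eqP b0; case: I0; exists b.
  exact: (is_ideal0 (ideal_gen_ideal _)).
by apply: ideal_gen_min.
Qed.

Lemma noetherian_surj (A B : comNzRingType) (f : {rmorphism A -> B}) :
  (forall b, exists a, f a = b) -> @noetherian A -> @noetherian B.
Proof.
move=> fsurj noethA I HI; have [|s Is] := noethA [set a | I (f a)].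
  split=> /=; first by rewrite rmorph0; exact: is_ideal0.
  by move=> a u v; rewrite rmorphD rmorphM; case: HI => _; apply.
exists (map f s); apply/seteqP; split=> b.
  have [a <-] := fsurj b => Ifa.
  have : [set a | I (f a)] a by [].
  rewrite Is; apply: (@ideal_gen_min _ _ [set a | ideal_gen [set` map f s] (f a)]).
    have Hs := ideal_gen_ideal [set` map f s].
    split=> /=; first by rewrite rmorph0; exact: is_ideal0.
    by move=> c u v; rewrite rmorphD rmorphM; case: Hs => _; apply.
  by move=> c cs; apply: sub_ideal_gen; exact: map_f.
apply: ideal_gen_min => // _ /mapP[a sa ->].
have : ideal_gen [set` s] a by exact: sub_ideal_gen.
by rewrite -Is.
Qed.

(* The ideals L n of the leading coefficients in degree at most n form an
   ascending chain that becomes stationary at some N, and lifts of generators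
   of the ideals L n, n <= N, generate I. *)
Lemma poly_noetherian (A : comNzRingType) :
  @noetherian A -> @noetherian {poly A}.
Proof.
move=> noethA I HI.
pose low n f := I f /\ (size f <= n.+1)%N.
pose L n : set A := [set a | exists2 f, low n f & f`_n = a].
have HL n : is_ideal (L n).
  split; first by exists 0; rewrite ?coef0 //; split; rewrite ?size_poly0 //; exact: is_ideal0.
  move=> a _ _ [f [If sf] <-] [g [Ig sg] <-]; exists (a *: f + g).
    split; first by rewrite -mul_polyC; case: HI => _; apply.
    rewrite (leq_trans (size_polyD _ _)) // geq_max sg andbT.
    exact: leq_trans (size_scale_leq _ _) sf.
  by rewrite coefD coefZ.
have LS n k : L n `<=` L (n + k)%N.
  move=> _ [f [If sf] <-]; exists (f * 'X^k).
    split; first exact: is_idealMr.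
    by rewrite (leq_trans (size_polyMleq _ _)) // size_polyXn addnS /= -addSn leq_add2r.
  by rewrite coefMXn ltnNge leq_addl /= addnK.
have /choice[t Lt] n : exists s : seq A, L n = ideal_gen [set` s] by exact: (noethA _ (HL n)).
have [s Ls] : exists s : seq A, \bigcup_n L n = ideal_gen [set` s].
  apply: (noethA (\bigcup_n L n)); split; first by exists 0%N => //; exact: is_ideal0.
  move=> a u v [n _ Lu] [n' _ Lv]; exists (n + n')%N => //.
  by case: (HL (n + n')%N) => _; apply; [exact: LS|rewrite addnC; exact: LS].
have [N LN] : exists N, forall n, L n `<=` L N.
  suff [N sN] : exists N, [set` s] `<=` L N.
    exists N => n a La; apply: (ideal_gen_min (HL N) sN).
    by rewrite -Ls; exists n.
  have : [set` s] `<=` \bigcup_n L n by rewrite Ls; exact: sub_ideal_gen.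
  elim: s {Ls} => [|a s IHs] sL; first by exists 0%N.
  have [|N sN] := IHs; first by move=> b bs; apply: sL; rewrite /= inE [_ \in _]bs orbT.
  have [|n _ La] := sL a; first by rewrite /= mem_head.
  exists (N + n)%N => b; rewrite /= inE => /orP[/eqP ->|/sN /LS //].
  by rewrite addnC; exact: LS.
(* A choice of lifts of leading coefficients; [pre (n, a)] is arbitrary when [a] is not in [L n]. *)
have /choice[pre Hpre] (na : nat * A) :
    exists f, L na.1 na.2 -> low na.1 f /\ f`_na.1 = na.2.
  by have [[f ? ?]|?] := pselect (L na.1 na.2); [exists f|exists 0].
pose G := flatten [seq [seq pre (n, a) | a <- t n] | n <- iota 0 N.+1].
have HG := ideal_gen_ideal [set` G].
have tL n a : a \in t n -> L n a by rewrite Lt => ta; exact: sub_ideal_gen.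
have lift n a : (n <= N)%N -> L n a ->
    exists h, [/\ ideal_gen [set` G] h, (size h <= n.+1)%N & h`_n = a].
  move=> len; rewrite Lt; apply: (@ideal_gen_min _ _ [set a | exists h,
    [/\ ideal_gen [set` G] h, (size h <= n.+1)%N & h`_n = a]]).
    split.
      by exists 0; rewrite coef0 size_poly0; split=> //; exact: is_ideal0.
    move=> b _ _ [f [If sf <-]] [g [Ig sg <-]]; exists (b *: f + g); split.
    - by rewrite -mul_polyC; case: HG => _; apply.
    - rewrite (leq_trans (size_polyD _ _)) // geq_max sg andbT.
      exact: leq_trans (size_scale_leq _ _) sf.
    - by rewrite coefD coefZ.
  move=> b bt; have [[Ih sh] hb] := Hpre (n, b) (tL _ _ bt).
  exists (pre (n, b)); split=> //; apply: sub_ideal_gen; apply/flattenP.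
  exists [seq pre (n, a) | a <- t n]; last exact: map_f.
  by apply/mapP; exists n; rewrite // mem_iota.
exists G; apply/seteqP; split; last first.
  apply: ideal_gen_min => // _ /flattenP[_ /mapP[n _ ->] /mapP[a ta ->]].
  by have [[]] := Hpre (n, a) (tL _ _ ta).
move=> f; move: {2}(size f) (leqnn (size f)) => n.
elim: n f => [|n IHn] f sf If.
  by move: sf; rewrite leqn0 size_poly_eq0 => /eqP ->; exact: is_ideal0.
have Lf : L n f`_n by exists f.
(* An element of the generated ideal with the same coefficient as [f] in degree [n]; above degree
   [N] a lift from degree [N] is multiplied by a power of the variable. Subtracting it lowers the
   degree. *)
have [h [Gh sh hf]] : exists h,
    [/\ ideal_gen [set` G] h, (size h <= n.+1)%N & h`_n = f`_n].
  have [leNn|/ltnW ltNn] := leqP n N; first exact: lift.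
  have [h [Gh sh hf]] := lift N f`_n (leqnn _) (LN _ _ Lf).
  exists (h * 'X^(n - N)); split; first exact: (is_idealMr _ HG).
    rewrite (leq_trans (size_polyMleq _ _)) // size_polyXn addnS /=.
    by rewrite -{2}(subnKC ltNn) -addSn leq_add2r.
  by rewrite coefMXn ltnNge leq_subr /= subKn.
have GI : ideal_gen [set` G] `<=` I.
  apply: ideal_gen_min => // _ /flattenP[_ /mapP[k _ ->] /mapP[a ta ->]].
  by have [[]] := Hpre (k, a) (tL _ _ ta).
apply: (is_ideal_shift HG (v := h)) => //; apply: IHn; last first.
  by apply: is_idealB => //; exact: GI.
apply/leq_sizeP => k; rewrite leq_eqVlt coefB => /orP[/eqP <-|ltnk].
  by rewrite hf subrr.
by rewrite !nth_default ?subrr // (leq_trans _ ltnk).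
Qed.

(** Iterated, it evaluates polynomials in several variables: in [heval (heval iota s) t] the inner
    variable goes to [s] and the outer one to [t]. *)
Definition heval (R A : comNzRingType) (f : {rmorphism R -> A}) (u : A) :
    {rmorphism {poly R} -> A} :=
  horner_morph (fun x => mulrC u (f x)).

Lemma hevalC (R A : comNzRingType) (f : {rmorphism R -> A}) (u : A) c :
  heval f u c%:P = f c.
Proof. exact: horner_morphC. Qed.

Lemma hevalX (R A : comNzRingType) (f : {rmorphism R -> A}) (u : A) :
  heval f u 'X = u.
Proof. exact: horner_morphX. Qed.

Lemma heval_poly (R A : comNzRingType) (f : {rmorphism R -> A}) (u : A) n E :
  heval f u (\poly_(i < n) E i) = \sum_(i < n) f (E i) * u ^+ i.
Proof.
rewrite poly_def rmorph_sum; apply: eq_bigr => i _.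
by rewrite -mul_polyC rmorphM rmorphXn /= [heval _ _ _]hevalC [heval _ _ 'X]hevalX.
Qed.

Lemma mpoly_rmorphism_surj (R B : comNzRingType) n
    (f : {rmorphism B -> {mpoly R[n]}}) :
  (forall c, exists b, f b = c%:MP) -> (forall i, exists b, f b = 'X_i) ->
  forall p, exists b, f b = p.
Proof.
move=> fC fX p; rewrite (mpolyE p).
apply: (big_ind (fun q => exists b, f b = q)); first by exists 0; rewrite rmorph0.
  by move=> _ _ [a <-] [b <-]; exists (a + b); rewrite rmorphD.
move=> m _; have [c fc] := fC p@_m.
suff [b fb] : exists b, f b = 'X_[m].
  by exists (c * b); rewrite rmorphM fb fc mul_mpolyC.
rewrite mpolyXE_id.
apply: (big_ind (fun q => exists b, f b = q)); first by exists 1; rewrite rmorph1.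
  by move=> _ _ [a <-] [b <-]; exists (a * b); rewrite rmorphM.
by move=> i _; have [b fb] := fX i; exists (b ^+ m i); rewrite rmorphXn fb.
Qed.

(** Hilbert's basis theorem, by induction: [{poly {mpoly K[n]}}] maps onto [{mpoly K[n.+1]}], its
    variable going to the last one. *)
Lemma mpoly_noetherian (K : fieldType) n : @noetherian {mpoly K[n]}.
Proof.
elim: n => [|n IHn].
  apply: (noetherian_surj (f := @mpolyC 0 K)) (@field_noetherian K) => p.
  by exists p@_0%MM; rewrite /= -nvar0_mpolyC.
apply: (noetherian_surj (f := heval (@mwiden n K) 'X_ord_max)) (poly_noetherian IHn).
apply: mpoly_rmorphism_surj => [c|i].
  by exists (c%:MP%:P); rewrite hevalC /= mwidenC.
have [lti|] := ltnP i n; last first.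
  move=> gei; exists 'X; rewrite hevalX; congr 'X_[U_(_)]; apply: val_inj => /=.
  by apply/eqP; rewrite eqn_leq gei -ltnS ltn_ord.
exists ('X_(Ordinal lti))%:P; rewrite hevalC /= mwidenX mnmwiden1.
by congr 'X_[U_(_)]; apply: val_inj.
Qed.

End Noetherian.

(** * Dimension and maximal ideals of finite algebras *)

Section Dimension.

(** While the constant coefficient of [F] is 0, a factor ['X] can be cancelled, because [Q] is prime
    and does not contain [x]. Once it is nonzero, it is the value of [F] modulo [x], hence lies in
    [Q']. *)
Lemma heval_low_coef (R A : comNzRingType) (f : {rmorphism R -> A}) (x : A)
    (Q Q' : set A) (F : {poly R}) :
  prime_ideal Q -> is_ideal Q' -> Q `<=` Q' -> ~ Q x -> Q' x ->
  F != 0 -> Q (heval f x F) -> exists2 c, c != 0 & Q' (f c).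
Proof.
move=> [HQ _ QM] HQ' QQ' Qx Q'x; elim/poly_ind: F => [|F c IHF]; first by rewrite eqxx.
rewrite rmorphD rmorphM /= hevalX hevalC.
have [->|c0 _ QF] := eqVneq c 0.
  rewrite !rmorph0 !addr0; have [->|F0 _] := eqVneq F 0; first by rewrite mul0r eqxx.
  by move=> /QM[|//]; exact: IHF.
exists c => //; rewrite -[f c](addKr (heval f x F * x)) addrC.
apply: is_idealD => //; first exact: QQ'.
by apply: is_idealN => //; exact: is_idealMl.
Qed.

(** Choose [x1], [x2], [x3] in the successive differences of a chain of length 3. Passing to a low
    coefficient removes one variable of their algebraic relation per step of the chain, and finally
    puts a nonzero constant into the top prime. *)
Lemma prime_height_lt3 (K : fieldType) (A : comNzRingType)
    (iota : {rmorphism K -> A}) :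
  (forall x1 x2 x3 : A, exists2 F : {poly {poly {poly K}}}, F != 0 &
     heval (heval (heval iota x3) x2) x1 F = 0) ->
  forall P : set A, prime_ideal P -> ~ prime_height_ge P 3.
Proof.
move=> dep P _ [Q [Q1 Q2 _]].
have step i : (i < 3)%N -> exists2 x, ~ Q i x & Q i.+1 x.
  move=> /Q2[_ nsub]; apply: contrapT => nex; apply: nsub => x Qx.
  by apply: contrapT => nQx; apply: nex; exists x.
have sub i : (i < 3)%N -> Q i `<=` Q i.+1 by move=> /Q2[].
have [x1 nx1 Qx1] := step 0%N isT; have [x2 nx2 Qx2] := step 1%N isT.
have [x3 nx3 Qx3] := step 2%N isT.
have idQ i : (i <= 3)%N -> is_ideal (Q i) by move=> /Q1[].
have [F F0 HF] := dep x1 x2 x3.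
have QF : Q 0%N (heval (heval (heval iota x3) x2) x1 F).
  by rewrite HF; apply: is_ideal0; exact: idQ.
have [F1 F10 HF1] := heval_low_coef (Q1 0%N isT) (idQ 1%N isT) (sub 0%N isT) nx1 Qx1 F0 QF.
have [F2 F20 HF2] := heval_low_coef (Q1 1%N isT) (idQ 2%N isT) (sub 1%N isT) nx2 Qx2 F10 HF1.
have [c c0 Hc] := heval_low_coef (Q1 2%N isT) (idQ 3%N isT) (sub 2%N isT) nx3 Qx3 F20 HF2.
have [_ nQ1 _] := Q1 3%N isT; apply: nQ1.
by rewrite -(rmorph1 iota) -(mulVf c0) rmorphM; apply: is_idealMl => //; exact: idQ.
Qed.

Lemma linear_dependence (K : fieldType) (T1 T2 : finType) (f : T1 -> T2 -> K) :
  (#|T2| < #|T1|)%N ->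
  exists2 v : T1 -> K, exists t, v t != 0 & forall t2, \sum_t v t * f t t2 = 0.
Proof.
move=> ltT; pose M := \matrix_(i < #|T1|, j < #|T2|) f (enum_val i) (enum_val j).
have /rowV0Pn[v /sub_kermxP vM /rV0Pn[i v0]] : kermx M != 0.
  rewrite kermx_eq0 /row_free; apply: contraTneq ltT => <-.
  by rewrite -leqNgt rank_leq_col.
exists (fun t => v ord0 (enum_rank t)).
  by exists (enum_val i); rewrite enum_valK; move: v0; rewrite (ord1 0).
move=> t2; have /matrixP/(_ ord0 (enum_rank t2)) := vM.
rewrite !mxE => {2}<-; rewrite (reindex (@enum_val T1 T1)) /=; last first.
  by exists enum_rank => t _; rewrite (enum_valK, enum_rankK).
by apply: eq_bigr => k _; rewrite !mxE enum_valK enum_rankK.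
Qed.

(* The N^3 monomials of degree less than N in each of x1, x2, x3 lie in a space
   whose dimension grows like N^2. *)
Lemma quadratic_growth_dependence (K : fieldType) (A : comNzRingType)
    (iota : {rmorphism K -> A}) (V : nat -> set A) (r : nat)
    (w : nat -> nat -> 'I_r -> A) :
  (forall n n', (n <= n')%N -> V n `<=` V n') -> V 0%N 1 ->
  (forall i j a b, V i a -> V j b -> V (i + j)%N (a * b)) ->
  (forall a, exists n, V n a) ->
  (forall n a, V n a -> exists l : 'I_n.+1 * 'I_n.+1 * 'I_r -> K,
     a = \sum_t iota (l t) * w t.1.1 t.1.2 t.2) ->
  forall x1 x2 x3 : A, exists2 F : {poly {poly {poly K}}}, F != 0 &
    heval (heval (heval iota x3) x2) x1 F = 0.
Proof.
move=> Vmon V1 VM Vex Vspan x1 x2 x3.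
have VX x d i n : V d x -> (i <= n)%N -> V (d * n)%N (x ^+ i).
  move=> Vx lei; apply: (Vmon (d * i)%N); first by rewrite leq_mul2l lei orbT.
  elim: i {lei} => [|i IHi]; first by rewrite muln0 expr0.
  by rewrite exprSr mulnSr; exact: VM.
have [d1 Vx1] := Vex x1; have [d2 Vx2] := Vex x2; have [d3 Vx3] := Vex x3.
(* With D = d1 + d2 + d3 one has M + 1 <= (D + 1)(N + 1), so r (M + 1)^2 <= N (N + 1)^2 < (N + 1)^3:
   there are more monomials than spanning elements. *)
pose N := (r * (d1 + d2 + d3).+1 ^ 2)%N; pose M := ((d1 + d2 + d3) * N)%N.
pose mon (t : 'I_N.+1 * 'I_N.+1 * 'I_N.+1) : A :=
  x3 ^+ t.2 * x2 ^+ t.1.2 * x1 ^+ t.1.1.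
have /choice[f Hf] (t : 'I_N.+1 * 'I_N.+1 * 'I_N.+1) :
    exists l : 'I_M.+1 * 'I_M.+1 * 'I_r -> K,
      mon t = \sum_t iota (l t) * w t.1.1 t.1.2 t.2.
  apply: Vspan; have -> : M = (d3 * N + d2 * N + d1 * N)%N by rewrite /M; lia.
  by apply: (VM); [apply: (VM)|]; apply: (VX) => //; rewrite -ltnS.
have [|v [[[i1 i2] i3] v0] Hv] := @linear_dependence K _ _ f.
  rewrite !card_prod !card_ord; apply: (@leq_ltn_trans (r * ((d1 + d2 + d3).+1 * N.+1) ^ 2)).
    by rewrite mulnC leq_mul2l mulnn leq_sqr mulSn /M; apply/orP; right; nia.
  by rewrite expnMn mulnA -/N mulnn [ltnRHS]mulnC ltn_mul2r expn_gt0 ltnSn.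
pose E i j k := v (inord i, inord j, inord k).
exists (\poly_(i < N.+1) \poly_(j < N.+1) \poly_(k < N.+1) E i j k).
  apply: contra_neq v0 => /(congr1 (fun F : {poly {poly {poly K}}} => F`_i1`_i2`_i3)).
  by rewrite !coef_poly !ltn_ord !coef_poly !ltn_ord coef_poly ltn_ord !coef0 /E !inord_val.
rewrite heval_poly; transitivity (\sum_t iota (v t) * mon t).
  transitivity (\sum_i \sum_j \sum_k iota (v (i, j, k)) * mon (i, j, k)); last first.
    by rewrite !pair_bigA /=; apply: eq_bigr => -[[i j] k].
  apply: eq_bigr => i _; rewrite heval_poly mulr_suml; apply: eq_bigr => j _.
  rewrite heval_poly !mulr_suml; apply: eq_bigr => k _.
  by rewrite /E !inord_val /mon /= !mulrA.
under eq_bigr => t _ do rewrite Hf mulr_sumr.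
rewrite exchange_big big1 //= => t2 _.
under eq_bigr => t _ do rewrite mulrA -rmorphM.
by rewrite -mulr_suml -rmorph_sum Hv rmorph0 mul0r.
Qed.

End Dimension.

(** * Maximal ideals of finite algebras over K[s, t] *)

Section Zariski.

(** Modulo [h] both matrices agree, and so do the terms of their Leibniz expansions. *)
Lemma det_sub_scale (R : comNzRingType) n (X Y : 'M[R]_n) (h : R) :
  exists b, \det (X - h *: Y) = \det X + h * b.
Proof.
pose J : set R := [set u | exists b, u = h * b].
have HJ : is_ideal J.
  split; first by exists 0; rewrite mulr0.
  by move=> a _ _ [b ->] [b' ->]; exists (a * b + b'); ring.
suff [b eb] : J (\det (X - h *: Y) - \det X) by exists b; rewrite -eb [RHS]addrC subrK.
rewrite /determinant -sumrB; apply: is_ideal_sum => // s.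
rewrite -mulrBr; apply: is_idealMl => //.
apply: (big_rec2 (fun u v => J (u - v))) => [|i u v _ [b eb]].
  by rewrite subrr; exact: is_ideal0.
exists (X i (s i) * b - Y i (s i) * u).
rewrite !mxE; have -> : u = h * b + v by rewrite -eb subrK.
by ring.
Qed.

(* If q is an inverse of phi h modulo P, multiplying the relations
   phi a ^+ k * q * e i = \sum_j phi (M i j) * e j by phi h shows that
   a^k - h M maps to a singular matrix, hence has determinant 0. *)
Lemma finite_mod_maximal_dvd (R A : comNzRingType) (phi : {rmorphism R -> A})
    (P : set A) (r : nat) (e : 'I_r -> A) (i0 : 'I_r) (a h : R) :
  maximal_ideal P -> (forall u, P (phi u) -> u = 0) -> e i0 = 1 ->
  (forall u, exists k, exists M : 'I_r -> R,
     P (phi a ^+ k * u - \sum_j phi (M j) * e j)) ->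
  h != 0 -> exists k b, a ^+ k = h * b.
Proof.
move=> mP inj e1 span h0; have [HP _ _] := mP.
have [q Hq] : exists q, P (q * phi h - 1).
  by apply: maximal_ideal_inv => // /inj; apply/eqP.
have /choice[kM HkM] (i : 'I_r) : exists kM : nat * ('I_r -> R),
    P (phi a ^+ kM.1 * (q * e i) - \sum_j phi (kM.2 j) * e j).
  by have [k [M HM]] := span (q * e i); exists (k, M).
(* A common exponent for all [e i]; the missing powers of [a] go into the matrix [M]. *)
pose k := \max_i (kM i).1.
pose M : 'M[R]_r := \matrix_(i, j) (a ^+ (k - (kM i).1) * (kM i).2 j).
pose X : 'M[R]_r := (a ^+ k)%:M - h *: M.
have Xe i : P (\sum_j phi (X i j) * e j).
  have -> : \sum_j phi (X i j) * e j =
      phi a ^+ k * e i - phi h * \sum_j phi (M i j) * e j.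
    rewrite mulr_sumr (bigD1 i) //= [in RHS](bigD1 i) //= opprD addrA -sumrN.
    have XE j : X i j = a ^+ k *+ (i == j) - h * M i j by rewrite !mxE.
    congr (_ + _); first by rewrite XE eqxx mulr1n rmorphB rmorphM rmorphXn; ring.
    apply: eq_bigr => j ji; rewrite XE eq_sym (negbTE ji) mulr0n.
    by rewrite rmorphB rmorphM rmorph0; ring.
  have lek : ((kM i).1 <= k)%N by rewrite /k (bigD1 i) //= leq_maxl.
  have -> : \sum_j phi (M i j) * e j =
      phi a ^+ (k - (kM i).1) * \sum_j phi ((kM i).2 j) * e j.
    rewrite mulr_sumr; apply: eq_bigr => j _.
    by rewrite mxE rmorphM rmorphXn mulrA.
  set S := \sum_j _; set d := (k - _)%N.
  have -> : phi a ^+ k = phi a ^+ d * phi a ^+ (kM i).1.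
    by rewrite -exprD subnK.
  have -> : phi a ^+ d * phi a ^+ (kM i).1 * e i - phi h * (phi a ^+ d * S) =
      (phi h * phi a ^+ d) * (phi a ^+ (kM i).1 * (q * e i) - S) -
      phi a ^+ d * phi a ^+ (kM i).1 * e i * (q * phi h - 1) by ring.
  by apply: is_idealB => //; apply: is_idealMl => //; exact: HkM.
(* Multiplying by the adjugate gives [phi (\det X) * e i] in [P] for each [i]; at [i0], where [e] is
   1, this is [phi (\det X)] itself. *)
have detX : \det X = 0.
  apply: inj; pose Y := map_mx phi X.
  have -> : phi (\det X) = \sum_i (\adj Y) i0 i * \sum_j phi (X i j) * e j.
    rewrite -det_map_mx -/Y.
    transitivity ((\adj Y *m Y *m (\col_j e j)) i0 ord0).
      rewrite mul_adj_mx mul_scalar_mx !mxE.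
      by rewrite e1 mulr1.
    rewrite -mulmxA mxE; apply: eq_bigr => i _; congr (_ * _).
    by rewrite mxE; apply: eq_bigr => j _; rewrite !mxE.
  by apply: is_ideal_sum => // i; apply: is_idealMl.
have [b] := det_sub_scale ((a ^+ k)%:M) M h; rewrite -/X detX det_scalar -exprM.
by exists (k * r)%N, (- b); rewrite mulrN; apply/eqP; rewrite -addr_eq0; apply/eqP.
Qed.

(** Suppose K[s] embeds into A / P. A nonzero relation [g] for [t] over K[s] makes A / P finite over
    K[s] up to powers of its leading coefficient [a]. Every nonzero [h] in K[s] would then divide a
    power of [a], which fails for h = 1 + X a. *)
Lemma maximal_ideal_algebraic (K : fieldType) (A : comNzRingType)
    (iota : {rmorphism K -> A}) (s t : A) (r : nat) (e : 'I_r -> A) (i0 : 'I_r)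
    (P : set A) :
  maximal_ideal P -> e i0 = 1 ->
  (forall u, exists p : 'I_r -> {poly {poly K}},
     u = \sum_j heval (heval iota s) t (p j) * e j) ->
  exists2 f : {poly K}, f != 0 & P (heval iota s f).
Proof.
move=> mP e1 span; have [HP P1 _] := mP.
set phi := heval (heval iota s) t; apply: contrapT => nex.
have inj (f : {poly K}) : P (heval iota s f) -> f = 0.
  by move=> Pf; apply: contrapT => /eqP f0; apply: nex; exists f.
(* Otherwise K[s, t] embeds into A / P, and by finiteness, with [a := 1], the outer variable would
   divide 1. *)
have [g g0 Pg] : exists2 g, g != 0 & P (phi g).
  apply: contrapT => nexg.
  have injg g : P (phi g) -> g = 0.
    by move=> Pg; apply: contrapT => /eqP g0; apply: nexg; exists g.
  have [||k [b]] := finite_mod_maximal_dvd (a := 1) (h := 'X) mP injg e1.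
  - move=> u; have [p ->] := span u; exists 0%N, p.
    by rewrite expr0 mul1r subrr; exact: is_ideal0.
  - by rewrite polyX_eq0.
  rewrite expr1n => /(congr1 (fun q : {poly {poly K}} => q`_0)) /eqP.
  by rewrite coefC coefXM /= oner_eq0.
pose a := lead_coef g.
have a0 : a != 0 by rewrite lead_coef_eq0.
have sg : (0 < size g)%N by rewrite size_poly_gt0.
pose n := size g.
(* Remainders modulo [g] have degree in [t] below [size g], so these products span A / P over K[s]
   up to powers of [a]. *)
pose e' (k : 'I_#|{: 'I_n * 'I_r}|) : A := t ^+ (enum_val k).1 * e (enum_val k).2.
have e'E (c : 'I_n -> 'I_r -> A) :
    \sum_k c (enum_val k).1 (enum_val k).2 * e' k =
    \sum_j (\sum_i c i j * t ^+ i) * e j.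
  under [RHS]eq_bigr => j _ do rewrite mulr_suml.
  rewrite exchange_big pair_bigA /= [RHS]big_enum_val /=.
  by apply: eq_bigr => k _; rewrite /e' mulrA.
have e'1 : e' (enum_rank (Ordinal sg, i0)) = 1.
  by rewrite /e' enum_rankK /= expr0 e1 mul1r.
have [||k [b eb]] := finite_mod_maximal_dvd (a := a) (h := 1 + 'X * a) mP inj e'1.
- move=> u; have [p ->] := span u.
  (* Pseudo-division of [p j] by [g] multiplies [p j] by [a ^+ scalp (p j) g]; the maximum serves
     all [j] at once. *)
  pose k := \max_j scalp (p j) g.
  pose q j := a ^+ (k - scalp (p j) g) *: (p j %% g).
  exists k, (fun k : 'I_#|{: 'I_n * 'I_r}| => (q (enum_val k).2)`_(enum_val k).1).
  rewrite (e'E (fun i j => heval iota s (q j)`_i)) mulr_sumr -sumrB.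
  apply: is_ideal_sum => // j.
  have -> : \sum_(i < n) heval iota s (q j)`_i * t ^+ i = phi (q j).
    rewrite -heval_poly; congr (phi _); apply/polyP => i; rewrite coef_poly.
    case: ltnP => // lei; rewrite nth_default // (leq_trans _ lei) //.
    by rewrite (leq_trans (size_scale_leq _ _)) // ltnW // ltn_modp.
  rewrite mulrA -mulrBl; apply: is_idealMr => //.
  have -> : heval iota s a ^+ k = phi (a ^+ k)%:P by rewrite hevalC rmorphXn.
  rewrite -rmorphM -rmorphB mul_polyC.
  have -> : a ^+ k *: p j - q j = (a ^+ (k - scalp (p j) g) *: (p j %/ g)) * g.
    have lek : (scalp (p j) g <= k)%N by rewrite /k (bigD1 j) //= leq_maxl.
    rewrite -{1}(subnK lek) exprD -scalerA Pdiv.WeakIdomain.divp_eq -/a scalerDr -scalerAl.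
    by rewrite addrK.
  by rewrite rmorphM; apply: is_idealMl.
- apply/eqP => /(congr1 (fun p : {poly K} => p`_0)) /eqP.
  by rewrite coefD coefXM coef1 coef0 addr0 oner_eq0.
have : 1 + 'X * a %| a ^+ k by rewrite eb dvdp_mulr.
(* 1 + X a is coprime to [a]; being a nonconstant polynomial, it cannot divide a power of [a]. *)
have cop : coprimep (1 + 'X * a) (a ^+ k).
  apply: coprimep_expr; rewrite coprimep_sym; apply/Bezout_eq1_coprimepP.
  by exists (- 'X, 1) => /=; ring.
move=> dvd; have /coprimepP/(_ _ (dvdpp _) dvd)/eqp_size := cop.
rewrite size_poly1 addrC size_polyDl ?size_poly1 mulrC size_mulX // ?ltnS ?size_poly_gt0 //.
by move=> [] /eqP; rewrite size_poly_eq0 (negbTE a0).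
Qed.

End Zariski.

(** * Algebras that are free of finite rank over K[s, t] *)

Section RegularPair.

(** The top coefficient of [g * p] is that of [p] times a unit, so [f] divides the leading
    coefficient of [p]; the leading term is then removed and the argument repeated. *)
Lemma dvd_mul_monic_coef (K : fieldType) (f : {poly K}) (g p : {poly {poly K}}) :
  lead_coef g \is a GRing.unit -> (forall i, f %| (g * p)`_i) ->
  forall i, f %| p`_i.
Proof.
move=> ug; have g0 : g != 0 by rewrite -lead_coef_eq0; apply: contraTneq ug => ->; rewrite unitr0.
move: {2}(size p) (leqnn (size p)) => n; elim: n p => [|n IHn] p sp fgp i.
  by move: sp; rewrite leqn0 size_poly_eq0 => /eqP ->; rewrite coef0 dvdp0.
have [->|p0] := eqVneq p 0; first by rewrite coef0 dvdp0.
have fp : f %| lead_coef p.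
  have := fgp (size (g * p)).-1; rewrite -lead_coefE lead_coefM.
  by rewrite -{2}[lead_coef p](mulKr ug) => h; apply: dvdp_mull.
pose d := (size p).-1; pose q := p - lead_coef p *: 'X^d.
have ep : p = q + lead_coef p *: 'X^d by rewrite subrK.
rewrite ep coefD coefZ dvdp_add ?dvdp_mulr //; apply: IHn.
  apply/leq_sizeP => k ltnk; rewrite coefB coefZ coefXn.
  have [->|kd] := eqVneq k d; first by rewrite mulr1 lead_coefE subrr.
  rewrite mulr0 subr0 nth_default //; move: kd sp ltnk; rewrite /d.
  by rewrite polySpred //= => /eqP; lia.
move=> k; rewrite mulrBr coefB dvdp_sub // -scalerAr coefZ.
exact: dvdp_mulr.
Qed.

End RegularPair.

Section FiniteFree.
Context {K : fieldType} {A : comNzRingType} (iota : {rmorphism K -> A}).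

Lemma poly2_span (s t : A) (r n : nat) (e : 'I_r -> A)
    (l : 'I_n -> 'I_n -> 'I_r -> K) :
  exists p : 'I_r -> {poly {poly K}},
    \sum_j heval (heval iota s) t (p j) * e j =
    \sum_j (\sum_b \sum_a iota (l a b j) * s ^+ a * t ^+ b) * e j.
Proof.
case: n l => [|n] l.
  exists (fun=> 0); rewrite !big1 // => j _; first by rewrite big_ord0 mul0r.
  by rewrite rmorph0 mul0r.
exists (fun j => \poly_(b < n.+1) \poly_(a < n.+1) l (inord a) (inord b) j).
apply: eq_bigr => j _; congr (_ * _); rewrite heval_poly; apply: eq_bigr => b _.
rewrite heval_poly mulr_suml; apply: eq_bigr => a _.
by rewrite !inord_val.
Qed.

Section FreeModule.
Variables (s t : A) (r : nat) (e : 'I_r -> A).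
Hypothesis span : forall u, exists p : 'I_r -> {poly {poly K}},
  u = \sum_j heval (heval iota s) t (p j) * e j.
Hypothesis free : forall p : 'I_r -> {poly {poly K}},
  \sum_j heval (heval iota s) t (p j) * e j = 0 -> forall j, p j = 0.

Lemma free_regular1 f a : f != 0 -> heval iota s f * a = 0 -> a = 0.
Proof.
move=> f0; have [p ->] := span a.
have -> : heval iota s f = heval (heval iota s) t f%:P by rewrite hevalC.
rewrite mulr_sumr; under eq_bigr => j _ do rewrite mulrA -rmorphM.
move=> /free p0; rewrite big1 // => j _.
have /eqP := p0 j; rewrite mulf_eq0 polyC_eq0 (negbTE f0) => /eqP ->.
by rewrite rmorph0 mul0r.
Qed.

(** By freeness the equation holds in each coordinate: g(t) p_j = f(s) q_j. As a polynomial in t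
    over K[s], g(t) has a unit as leading coefficient, so f(s) divides all coefficients of p_j. *)
Lemma free_regular2 f g a b : g != 0 ->
  heval iota t g * a = b * heval iota s f -> exists d, a = d * heval iota s f.
Proof.
move=> g0; set phi := heval (heval iota s) t.
have [p ->] := span a; have [q ->] := span b.
have -> : heval iota s f = phi f%:P by rewrite [phi _]hevalC.
have -> : heval iota t g = phi (map_poly polyC g).
  rewrite -{1}[g]coefK heval_poly.
  rewrite (_ : map_poly _ _ = \poly_(i < size g) (g`_i)%:P) //.
  by rewrite [RHS]heval_poly; apply: eq_bigr => i _; rewrite [heval iota s _]hevalC.
rewrite mulr_sumr mulr_suml => /eqP; rewrite -subr_eq0 -sumrB => /eqP.
have -> : \sum_j (phi (map_poly polyC g) * (phi (p j) * e j) -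
                  phi (q j) * e j * phi f%:P) =
          \sum_j phi (map_poly polyC g * p j - f%:P * q j) * e j.
  by apply: eq_bigr => j _; rewrite rmorphB !rmorphM; ring.
move=> /free pq.
exists (\sum_j phi (\poly_(i < size (p j)) ((p j)`_i %/ f)) * e j).
rewrite mulr_suml; apply: eq_bigr => j _; rewrite mulrAC -rmorphM.
congr (phi _ * _); apply/polyP => i; rewrite coefMC coef_poly.
case: ltnP => [_|lei]; last by rewrite nth_default // mul0r.
rewrite divpK //; apply: (@dvd_mul_monic_coef K f (map_poly polyC g)) => [|k].
  rewrite lead_coef_map_inj //; last exact: polyC_inj.
  by rewrite poly_unitE size_polyC coefC eqxx lead_coef_eq0 g0 unitfE lead_coef_eq0.
by have /eqP := pq j; rewrite subr_eq0 => /eqP ->; rewrite coefCM dvdp_mulr.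
Qed.

End FreeModule.

(** The filtration [V] has quadratic growth, which excludes chains of primes of length 3; it also
    shows that [e] spans over K[s, t]. Freeness turns the nonzero polynomials in [s] and in [t]
    found in a maximal ideal into a regular sequence. *)
Lemma finite_free_cohen_macaulay (s t : A) (r : nat) (e : 'I_r -> A) (i0 : 'I_r)
    (V : nat -> set A) :
  @noetherian A ->
  (forall n n', (n <= n')%N -> V n `<=` V n') -> V 0%N 1 ->
  (forall i j a b, V i a -> V j b -> V (i + j)%N (a * b)) ->
  (forall a, exists n, V n a) ->
  (forall n a, V n a -> exists l : 'I_n.+1 * 'I_n.+1 * 'I_r -> K,
     a = \sum_x iota (l x) * (s ^+ x.1.1 * t ^+ x.1.2 * e x.2)) ->
  e i0 = 1 ->
  (forall p : 'I_r -> {poly {poly K}},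
     \sum_j heval (heval iota s) t (p j) * e j = 0 -> forall j, p j = 0) ->
  cohen_macaulay A.
Proof.
move=> noethA Vmon V1 VM Vex Vspan e1 free.
have dep := @quadratic_growth_dependence _ _ iota V r
  (fun a b j => s ^+ a * t ^+ b * e j) Vmon V1 VM Vex Vspan.
have spanP u : exists p : 'I_r -> {poly {poly K}},
    u = \sum_j heval (heval iota s) t (p j) * e j.
  have [n /Vspan[l ->]] := Vex u.
  have [p ep] := poly2_span s t e (fun a b j => l (a, b, j)); exists p; rewrite {}ep.
  transitivity (\sum_x \sum_j iota (l (x, j)) * (s ^+ x.1 * t ^+ x.2 * e j)).
    by rewrite pair_bigA; apply: eq_bigr => -[].
  rewrite exchange_big; apply: eq_bigr => j _; rewrite exchange_big pair_bigA mulr_suml.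
  by apply: eq_bigr => -[a b] _ /=; rewrite !mulrA.
(* The roles of [s] and [t] are exchanged, since [maximal_ideal_algebraic] finds a polynomial in the
   inner variable. *)
have spanP' u : exists p : 'I_r -> {poly {poly K}},
    u = \sum_j heval (heval iota t) s (p j) * e j.
  have [n /Vspan[l ->]] := Vex u.
  have [p ep] := poly2_span t s e (fun a b j => l (b, a, j)); exists p; rewrite {}ep.
  transitivity (\sum_x \sum_j iota (l (x, j)) * (s ^+ x.1 * t ^+ x.2 * e j)).
    by rewrite pair_bigA; apply: eq_bigr => -[].
  rewrite exchange_big; apply: eq_bigr => j _; rewrite pair_bigA mulr_suml.
  by apply: eq_bigr => -[a b] _ /=; rewrite !mulrA; congr (_ * _); rewrite mulrAC.
apply: (@cohen_macaulay_criterion _ 2) => // [|P mP].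
  exact: prime_height_lt3 dep.
have [f f0 Pf] := maximal_ideal_algebraic mP e1 spanP.
have [g g0 Pg] := maximal_ideal_algebraic mP e1 spanP'.
pose F := heval iota s f; pose G := heval iota t g.
have [HP P1 _] := mP.
have sub : [set` [:: F; G]] `<=` P.
  by move=> x /=; rewrite !inE => /orP[] /eqP ->.
exists [:: F; G]; split=> //; split; last first.
  by move=> h; apply: P1; apply: (ideal_gen_min HP sub).
case=> [_ a /=|[_ a /=|//]].
  move=> /ideal_gen_nil /(free_regular1 spanP free f0) ->.
  exact: (is_ideal0 (ideal_gen_ideal _)).
move=> /ideal_gen_cons[b /ideal_gen_nil /eqP]; rewrite subr_eq0 => /eqP.
move=> /(free_regular2 spanP free g0)[d ->]; apply/ideal_gen_cons; exists d.
by rewrite subrr; exact: (is_ideal0 (ideal_gen_ideal _)).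
Qed.

End FiniteFree.

(** * Linear resolutions *)

Section Koszul.
Context {K : fieldType} {A : comNzRingType} (iota : {rmorphism K -> A}).
Context (gr : nat -> set A) (grA : graded_algebra iota gr).

Lemma gr_sum k (T : Type) (r : seq T) (F : T -> A) :
  (forall i, gr k (F i)) -> gr k (\sum_(i <- r) F i).
Proof.
have [_ /(_ k)[gr0 grB] _ _ _] := grA.
move=> grF; elim/big_ind: _ => // u v gu gv.
by rewrite -[v]opprK; apply: (grB) => //; rewrite -sub0r; exact: grB.
Qed.

Lemma gr_decomposition a : exists nf : nat * (nat -> A),
  [/\ forall k, gr k (nf.2 k), forall k, (nf.1 <= k)%N -> nf.2 k = 0
    & a = \sum_(k < nf.1) nf.2 k].
Proof.
have [_ grZ _ /(_ a)[n [f [grf ->]]] _] := grA.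
exists (n, fun k => if (k < n)%N then f k else 0); split => /=.
- by move=> k; case: ifP => // _; have [] := grZ k.
- by move=> k; rewrite ltnNge => ->.
- by apply: eq_bigr => k _; rewrite ltn_ord.
Qed.

(** The components of degree 2 are compared: only the degree-one part of [w] contributes to them. *)
Lemma linear_relation q p (D : 'M[A]_(q, p)) (x : 'rV[A]_p) (w : 'rV[A]_q) y :
  gr 1%N y -> (forall i j, gr 1%N (D i j)) -> (forall j, gr 1%N (x ord0 j)) ->
  y *: x = w *m D ->
  exists2 w' : 'rV[A]_q, (forall j, gr 1%N (w' ord0 j)) & y *: x = w' *m D.
Proof.
move=> gy gD gx yx; have [_ grZ grM _ gruniq] := grA.
have /choice[F HF] := gr_decomposition.
pose w' := \row_i (F (w ord0 i)).2 1%N.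
exists w'; first by move=> j; rewrite mxE; have [] := HF (w ord0 j).
apply/rowP => s; apply/eqP; rewrite -subr_eq0; apply/eqP.
(* The bound exceeds 1, so that the sums below contain the index 1 at which [y *: x] is placed. *)
pose N := (\max_i (F (w ord0 i)).1).+2.
have wE i : w ord0 i = \sum_(k < N) (F (w ord0 i)).2 k.
  have [_ F0 {1}->] := HF (w ord0 i).
  have leN : ((F (w ord0 i)).1 <= N)%N.
    by rewrite !leqW // (bigD1 i) //= leq_maxl.
  rewrite (big_ord_widen _ (fun k => (F (w ord0 i)).2 k) leN) big_mkcond.
  by apply: eq_bigr => k _; case: ltnP => // /F0 ->.
(* The component of degree [k] of the entry [s] of [y *: x - w *m D]: [D] raises degrees by one and
   [y *: x] has degree 2. *)
pose g k := if k is k'.+1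
  then (y *: x) ord0 s *+ (k' == 1%N) - \sum_i (F (w ord0 i)).2 k' * D i s else 0.
have gg k : gr k (g k).
  case: k => [|k]; first by have [] := grZ 0%N.
  have [gr0 grB] := grZ k.+1; apply: grB.
    case: eqP => [->|_]; last by rewrite mulr0n.
    by rewrite mulr1n mxE; exact: (grM 1%N 1%N).
  apply: gr_sum => i; rewrite -addn1; apply: grM => //.
  by have [] := HF (w ord0 i).
have /gruniq : \sum_(k < N.+1) g k = 0.
  rewrite big_ord_recl /= add0r /bump /= sumrB.
  have -> : \sum_(k < N) (y *: x) ord0 s *+ (k == 1%N :> nat) = (w *m D) ord0 s.
    rewrite -yx (bigD1 (Ordinal (isT : (1 < N)%N))) //= big1 ?addr0 // => k /negbTE.
    by rewrite -val_eqE /= => ->.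
  rewrite mxE exchange_big /= -sumrB big1 // => i _.
  by rewrite {1}wE mulr_suml subrr.
move=> /(_ gg 2%N isT); rewrite /g eqxx mulr1n => <-.
by rewrite !mxE; congr (_ - _); apply: eq_bigr => i _; rewrite mxE.
Qed.

Variables (m : nat) (y : nat -> A) (sigma : nat -> nat).

(** The ideal generated by the first [k] elements of [y]. The hypothesis [colon] makes these ideals
    a Koszul filtration: each successive colon ideal is again one of them. *)
Fixpoint flag (k : nat) : set A :=
  if k is k'.+1 then [set a | exists b c, flag k' b /\ a = b + c * y k'] else [set 0].

Hypothesis gr_y : forall k, (k < m)%N -> gr 1%N (y k).
Hypothesis sigma_le : forall k, (k < m)%N -> (sigma k <= m)%N.
Hypothesis colon : forall k, (k < m)%N ->
  forall a, flag k (a * y k) <-> flag (sigma k) a.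

Lemma flag_mon k k' : (k <= k')%N -> flag k `<=` flag k'.
Proof.
move=> /subnK <-; elim: (k' - k)%N => // d IHd a /IHd Fa.
by exists a, 0; rewrite mul0r addr0.
Qed.

Lemma flag_ideal k : is_ideal (flag k).
Proof.
elim: k => [|k [F0 FD]]; first exact: is_ideal_zero.
split; first by exists 0, 0; rewrite mul0r addr0.
move=> a _ _ [b [c [Fb ->]]] [b' [c' [Fb' ->]]].
by exists (a * b + b'), (a * c + c'); split; [exact: FD|ring].
Qed.

Lemma flag_y k k' : (k < k')%N -> flag k' (y k).
Proof.
move=> /flag_mon; apply; exists 0, 1; rewrite mul1r add0r; split=> //.
exact: (is_ideal0 (flag_ideal k)).
Qed.

(* The cokernel of such a matrix has a filtration whose quotients are the
   modules A / flag k, up to a shift of the degrees. *)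
Inductive koszul_mx (p : nat) : forall q, 'M[A]_(q, p) -> Prop :=
| KoszulNil (D : 'M[A]_(0, p)) : koszul_mx D
| KoszulCons q (D : 'M[A]_(q, p)) (x : 'rV[A]_p) k :
    koszul_mx D -> (forall j, gr 1%N (x ord0 j)) -> (k <= m)%N ->
    (forall a, (exists w, a *: x = w *m D) <-> flag k a) ->
    koszul_mx (col_mx D x).

Lemma koszul_mx_linear p q (D : 'M[A]_(q, p)) : koszul_mx D ->
  forall i j, gr 1%N (D i j).
Proof.
elim=> {q D} [D [] //|q D x k _ IH gx _ _ i j].
by rewrite mxE; case: split => i' //; rewrite (ord1 i').
Qed.

(** Used to regard syzygies of [D] as syzygies of a matrix with one more row. *)
Lemma koszul_mx_row0 p q (D : 'M[A]_(q, p)) : koszul_mx D ->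
  koszul_mx (row_mx D (0 : 'M_(q, 1))).
Proof.
have [_ /(_ 1%N)[gr0 _] _ _ _] := grA.
elim=> {q D} [D|q D x k _ IH gx lek colD]; first exact: KoszulNil.
have -> : row_mx (col_mx D x) 0 = col_mx (row_mx D 0) (row_mx x (0 : 'M_1)).
  by rewrite -[0 in LHS](@vsubmxK A q 1 1) -block_mxEh block_mxEv !linear0.
apply: (KoszulCons (k := k)) => // [j|a].
  by rewrite mxE; case: split => j' //; rewrite mxE.
rewrite -colD; split=> -[w e]; exists w.
  move: e; rewrite scale_row_mx mul_mx_row => /eq_row_mx[]//.
by rewrite scale_row_mx mul_mx_row e scaler0 mulmx0.
Qed.

(** Induction on the rows. The last coordinates of the syzygies of [col_mx D x] form [flag k], so
    the syzygies are filtered by the condition that the last coordinate lie in [flag j]. For [j = 0]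
    they come from [D]; each further step adds one generator, whose annihilator modulo the previous
    ones is a colon ideal. *)
Lemma koszul_mx_syzygy p q (D : 'M[A]_(q, p)) : koszul_mx D ->
  exists q' (D' : 'M[A]_(q', q)), koszul_mx D' /\
    forall v : 'rV_q, v *m D = 0 <-> exists w, v = w *m D'.
Proof.
elim=> {q D} [D|q D x k kD [q' [D' [kD' kerD]]] gx lek colD].
  exists 0%N, 0; split; first exact: KoszulNil.
  by move=> v; rewrite [v]thinmx0; split=> _; [exists 0; rewrite mul0mx|rewrite mul0mx].
have step j : (j <= k)%N -> exists r (E : 'M[A]_(r, q + 1)), koszul_mx E /\
    forall v : 'rV_(q + 1), (v *m col_mx D x = 0 /\ flag j (rsubmx v ord0 ord0)) <->
      exists w, v = w *m E.
  elim: j => [|j IHj] lej.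
    exists q', (row_mx D' 0); split; first exact: koszul_mx_row0.
    move=> v; rewrite -{1}[v]hsubmxK mul_row_col; split.
      move=> [+ v0]; have rv0 : rsubmx v = 0 by apply/rowP => i; rewrite (ord1 i) v0 mxE.
      rewrite rv0 mul0mx addr0 => /kerD[w lvE]; exists w.
      by rewrite mul_mx_row mulmx0 -lvE -rv0 hsubmxK.
    move=> [w ->]; rewrite mul_mx_row mulmx0 row_mxKl row_mxKr mul0mx addr0.
    by split; [apply/kerD; exists w|rewrite /= mxE].
  have [r [E [kE spanE]]] := IHj (ltnW lej).
  have ltjm : (j < m)%N by exact: leq_trans lek.
  have [u yu] : exists u, y j *: x = u *m D by apply/colD; exact: flag_y.
  have [u' gu' yu'] := linear_relation (gr_y ltjm) (koszul_mx_linear kD) gx yu.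
  (* The new generator: a linear syzygy with last coordinate [y j], which exists because [y j]
     annihilates [x] modulo the rows of [D]. *)
  pose z : 'rV[A]_(q + 1) := row_mx (- u') (y j)%:M.
  have zD : z *m col_mx D x = 0.
    by rewrite mul_row_col mulNmx -yu' mul_scalar_mx addNr.
  have zr : rsubmx z ord0 ord0 = y j by rewrite row_mxKr mxE eqxx.
  exists (r + 1)%N, (col_mx E z); split.
    apply: (KoszulCons (k := sigma j)) => //; last 2 first.
    - exact: sigma_le.
    (* [a *: z] is spanned by the previous syzygies exactly when its last coordinate [a * y j] lies
       in [flag j]. *)
    - move=> a; rewrite -colon // -spanE -scalemxAl zD scaler0.
      have -> : rsubmx (a *: z) ord0 ord0 = a * y j by rewrite linearZ /= mxE zr.
      by split=> [[]|].
    move=> i; rewrite mxE; case: split => i'.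
      have [_ /(_ 1%N)[gr0 grB] _ _ _] := grA.
      by rewrite mxE -sub0r; apply: grB.
    by rewrite mxE (ord1 i') eqxx mulr1n; exact: gr_y.
  move=> v; split.
    move=> [vD [b [c [Fb vE]]]].
    have [|w ew] := (spanE (v - c *: z)).1.
      rewrite mulmxBl vD -scalemxAl zD scaler0 subr0; split=> //.
      by rewrite linearB linearZ /= mxE [X in _ + X]mxE [X in _ - X]mxE zr vE addrK.
    exists (row_mx w c%:M); rewrite mul_row_col -ew mul_scalar_mx.
    by rewrite subrK.
  move=> [w ->]; rewrite -[w]hsubmxK mul_row_col.
  have [e1 e2] := (spanE (lsubmx w *m E)).2 (ex_intro _ _ erefl).
  rewrite [rsubmx w]mx11_scalar mul_scalar_mx mulmxDl e1 -scalemxAl zD scaler0 addr0.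
  split=> //; exists (rsubmx (lsubmx w *m E) ord0 ord0), (rsubmx w ord0 ord0); split=> //.
  by rewrite linearD linearZ /= mxE [X in _ + X]mxE zr.
(* For [j = k] the condition on the last coordinate holds for every syzygy. *)
have [r [E [kE spanE]]] := step k (leqnn k).
exists r, E; split=> // v; rewrite -spanE; split=> [vD|[]//]; split=> //.
apply/colD; exists (- lsubmx v); rewrite mulNmx.
move: vD; rewrite -{1}[v]hsubmxK mul_row_col => /eqP.
rewrite addrC addr_eq0 => /eqP <-.
by rewrite [in RHS](mx11_scalar (rsubmx v)) mul_scalar_mx.
Qed.

Lemma koszul_mx_flag j : (j <= m)%N -> exists q (D : 'M[A]_(q, 1)), koszul_mx D /\
  forall v : 'rV_1, flag j (v ord0 ord0) <-> exists w, v = w *m D.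
Proof.
elim: j => [|j IHj] lej.
  exists 0%N, 0; split; first exact: KoszulNil.
  move=> v; split=> [v0|[w ->]]; last by rewrite mulmx0 mxE.
  by exists 0; rewrite mulmx0; apply/rowP => i; rewrite (ord1 i) v0 mxE.
have [q [D [kD spanD]]] := IHj (ltnW lej).
exists (q + 1)%N, (col_mx D (y j)%:M); split.
  apply: (KoszulCons (k := sigma j)) => // [i||a].
  - by rewrite (ord1 i) mxE eqxx; exact: gr_y.
  - exact: sigma_le.
  - by rewrite -colon // -spanD !mxE eqxx.
move=> v; split.
  move=> [b [c [Fb vE]]]; have [|w ew] := (spanD (b%:M)).1; first by rewrite mxE eqxx.
  exists (row_mx w c%:M); rewrite mul_row_col -ew.
  by rewrite [LHS]mx11_scalar vE raddfD /= scalar_mxM.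
move=> [w ->]; rewrite -[w]hsubmxK mul_row_col [rsubmx w]mx11_scalar -scalar_mxM.
exists ((lsubmx w *m D) ord0 ord0), (rsubmx w ord0 ord0); split.
  by apply/spanD; exists (lsubmx w).
by rewrite mxE [X in _ + X]mxE eqxx.
Qed.

(** The sizes are bundled with the matrix so that taking syzygies can be iterated. *)
Record koszul_step := KoszulStep {
  ks_cols : nat; ks_rows : nat; ks_mx : 'M[A]_(ks_rows, ks_cols);
  ks_koszul : koszul_mx ks_mx }.

Lemma koszul_of_flag : irrelevant_ideal gr = flag m ->
  exists b d, @linear_resolution_of_residue_field A gr b d.
Proof.
move=> irrE.
have [q0 [D0 [kD0 spanD0]]] := koszul_mx_flag (leqnn m).
have /choice[nr Hnr] (s : koszul_step) : exists q', exists D' : 'M[A]_(q', ks_rows s),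
    koszul_mx D' /\ forall v : 'rV_(ks_rows s), v *m ks_mx s = 0 <-> exists w, v = w *m D'.
  exact: koszul_mx_syzygy (ks_koszul s).
pose nx s := KoszulStep (proj1 (svalP (cid (Hnr s)))).
have nxP s (v : 'rV_(ks_rows s)) : v *m ks_mx s = 0 <-> exists w, v = w *m ks_mx (nx s).
  exact: (proj2 (svalP (cid (Hnr s)))).
pose st i := iter i nx (KoszulStep kD0).
exists (fun i => ks_rows (st i)).
(* The case distinction lets [resolution_rank] compute; the first differential is the column of
   generators of [flag m], the others are iterated syzygies. *)
exists (fun i => match i return
  'M_(resolution_rank (fun i => ks_rows (st i)) i.+1,
      resolution_rank (fun i => ks_rows (st i)) i) with
  | 0%N => D0 | i'.+1 => ks_mx (nx (st i')) end).
split.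
- case=> [|i] r s; first exact: koszul_mx_linear kD0 _ _.
  exact: koszul_mx_linear (ks_koszul (nx (st i))) _ _.
- by move=> v; rewrite irrE; exact: spanD0.
- by case=> [|i] v; [exact: (nxP (KoszulStep kD0))|exact: (nxP (st i.+1))].
Qed.

End Koszul.

(** * Monomials *)

Section Grevlex.
Context {n : nat}.
Implicit Types u v w : 'X_{1..n}.

Lemma grevlex_trans u v w : grevlex_lt u v -> grevlex_lt v w -> grevlex_lt u w.
Proof.
rewrite /grevlex_lt => /orP[duv|/andP[/eqP duv /existsP[i /andP[vui /forallP uv]]]].
  by move=> /orP[dvw|/andP[/eqP <- _]]; rewrite ?duv // (ltn_trans duv).
rewrite duv => /orP[-> //|/andP[dvw /existsP[k /andP[wvk /forallP vw]]]].
rewrite dvw; apply/orP; right; apply/existsP.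
have uvE (j : 'I_n) : (i < j)%N -> u j = v j by move=> ltij; apply/eqP; have := uv j; rewrite ltij.
have vwE (j : 'I_n) : (k < j)%N -> v j = w j by move=> ltkj; apply/eqP; have := vw j; rewrite ltkj.
have [ltik|ltki|/val_inj eik] := ltngtP i k.
- exists k; rewrite uvE // wvk; apply/forallP => j; apply/implyP => ltkj.
  by rewrite uvE ?vwE // (ltn_trans ltik).
- exists i; rewrite -vwE // vui; apply/forallP => j; apply/implyP => ltij.
  by rewrite uvE ?vwE // (ltn_trans ltki).
- subst k; exists i; rewrite (ltn_trans wvk vui).
  by apply/forallP => j; apply/implyP => ltij; rewrite uvE ?vwE.
Qed.

Lemma grevlex_irr u : ~ grevlex_lt u u.
Proof.
by rewrite /grevlex_lt ltnn eqxx /= => /existsP[i]; rewrite ltnn.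
Qed.

Lemma initial_monomial_uniq (R : comNzRingType) (f : {mpoly R[n]}) u v :
  initial_monomial grevlex_lt f u -> initial_monomial grevlex_lt f v -> u = v.
Proof.
move=> [fu Hu] [fv Hv]; apply: contrapT => /eqP uv.
by apply: (@grevlex_irr u); apply: grevlex_trans (Hv u fu uv) _; apply: Hu; rewrite // eq_sym.
Qed.

Definition lweight (f : 'I_n -> nat) w : nat := \sum_i w i * f i.

Lemma lweightD f u v : lweight f (u + v)%MM = (lweight f u + lweight f v)%N.
Proof. by rewrite -big_split; apply: eq_bigr => i _; rewrite mnmDE mulnDl. Qed.

Lemma lweightU f i : lweight f U_(i)%MM = f i.
Proof.
rewrite /lweight (bigD1 i) //= mnm1E eqxx mul1n big1 ?addn0 // => k ki.
by rewrite mnm1E eq_sym (negbTE ki).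
Qed.

Lemma lweight0 f : lweight f 0%MM = 0%N.
Proof. by rewrite /lweight big1 // => i _; rewrite mnm0E. Qed.

Lemma lweightMn f u k : lweight f (u *+ k)%MM = (lweight f u * k)%N.
Proof.
elim: k => [|k IHk]; first by rewrite mulm0n lweight0 muln0.
by rewrite mulmS lweightD IHk mulnS.
Qed.

Lemma lweight_gt0 f w : (0 < lweight f w)%N -> exists2 i, (0 < f i)%N & (U_(i) <= w)%MM.
Proof.
rewrite lt0n sum_nat_eq0 => /forallPn[i]; rewrite muln_eq0 negb_or => /andP[wi fi].
by exists i; rewrite ?lt0n // lep1mP.
Qed.

End Grevlex.

Section Expo.
Context {m q : nat} (c : 'I_m -> 'X_{1..q}).

(** The exponent of the image of a monomial when z_i is sent to ['X_[c i]]. *)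
Definition expo (w : 'X_{1..m}) : 'X_{1..q} := (\sum_i c i *+ w i)%MM.

Lemma expoD u v : expo (u + v)%MM = (expo u + expo v)%MM.
Proof.
apply/mnmP => i; rewrite mnmDE !mnm_sumE -big_split; apply: eq_bigr => k _.
by rewrite !mulmnE mnmDE mulnDr.
Qed.

Lemma expo0 : expo 0%MM = 0%MM.
Proof. by apply/mnmP => i; rewrite mnm_sumE mnm0E big1 // => k _; rewrite mulmnE mnm0E muln0. Qed.

Lemma expoU i : expo U_(i)%MM = c i.
Proof.
apply/mnmP => k; rewrite mnm_sumE (bigD1 i) //= big1 ?addn0 => [|p np].
  by rewrite mulmnE mnm1E eqxx muln1.
by rewrite mulmnE mnm1E eq_sym (negbTE np) muln0.
Qed.

Lemma expoMn u k : expo (u *+ k)%MM = (expo u *+ k)%MM.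
Proof.
elim: k => [|k IHk]; first by rewrite !mulm0n expo0.
by rewrite !mulmS expoD IHk.
Qed.

End Expo.

(** * Standard monomials and their exponent vectors *)

Section Staircase.
Context {n : nat} (c : 'I_n.+2 -> 'X_{1..2}).

Let x0 : 'I_2 := ord0.
Let x1 : 'I_2 := ord_max.

Definition inner (i : 'I_n.+2) : bool := (0 < i)%N && (i.+1 < n.+2)%N.

Definition std (w : 'X_{1..n.+2}) : bool := (lweight (fun i => inner i) w <= 1)%N.

(** The basis over K[s, t]: index 0 stands for the element 1, the other indices for the inner
    variables. *)
Definition emon (i : 'I_n.+1) : 'X_{1..n.+2} :=
  if i == ord0 then 0%MM else U_(widen_ord (leqnSn _) i)%MM.

Definition smon (a b : nat) (i : 'I_n.+1) : 'X_{1..n.+2} :=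
  (U_(ord0) *+ a + emon i + U_(ord_max) *+ b)%MM.

Lemma std_smon w : std w -> exists a b i, w = smon a b i.
Proof.
have std0 u : lweight (fun i => inner i) u = 0%N ->
    u = (U_(ord0) *+ u ord0 + U_(ord_max) *+ u ord_max)%MM.
  move=> /eqP; rewrite sum_nat_eq0 => /forallP u0.
  apply/mnmP => i; rewrite mnmDE !mulmnE !mnm1E.
  have [<-|i0] := eqVneq ord0 i; first by rewrite mul1n -val_eqE /= mul0n addn0.
  have [<-|im] := eqVneq ord_max i; first by rewrite mul0n mul1n.
  have := u0 i; rewrite muln_eq0 eqb0 => /orP[/eqP ->//|].
  rewrite /inner lt0n; move: i0 im; rewrite -!val_eqE /= eq_sym => -> /=.
  by have := ltn_ord i; lia.
rewrite /std; case e : (lweight (fun i => inner i) w) => [|[|//]] _.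
  exists (w ord0), (w ord_max), ord0; rewrite {1}(std0 _ e) /smon /emon eqxx.
  by rewrite addm0.
have [|i fi iw] := @lweight_gt0 _ (fun i => inner i) w; first by rewrite e.
have ew := submK iw; set u := (w - _)%MM in ew.
have /std0 eu : lweight (fun i => inner i) u = 0%N.
  by move: e; rewrite -ew lweightD lweightU; case: (inner i) fi => // _; lia.
move: fi; rewrite lt0b /inner => /andP[i0 ltin].
exists (u ord0), (u ord_max), (@Ordinal n.+1 i ltin).
rewrite -ew {1}eu /smon /emon -val_eqE /= eqn0Ngt i0 /= -addmA -[RHS]addmA.
by congr (_ + _)%MM; rewrite addmC; congr (U_(_) + _)%MM; apply: val_inj.
Qed.

Lemma mdeg_smon a b i : mdeg (smon a b i) = (a + (i != ord0) + b)%N.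
Proof.
rewrite /smon !mdegD !mdegMn !mdeg1 !mul1n /emon.
by case: eqP => _; rewrite ?mdeg0 ?mdeg1.
Qed.

Lemma smon_std a b i : std (smon a b i).
Proof.
rewrite /std /smon !lweightD !lweightMn !lweightU /inner /= ltnn mul0n add0n.
rewrite /emon; case: eqP => _; first by rewrite lweight0.
by rewrite lweightU addn0; exact: leq_b1.
Qed.

Hypothesis c_xdecr : forall i i' : 'I_n.+2, (i < i')%N -> (c i' x0 < c i x0)%N.
Hypothesis c_yincr : forall i i' : 'I_n.+2, (i < i')%N -> (c i x1 < c i' x1)%N.
Hypothesis c_first : c ord0 x1 = 0%N.
Hypothesis c_last : c ord_max x0 = 0%N.

(** The coordinates of inner vectors lie strictly between 0 and the extreme values, so [a <= a'] and
    [b <= b']. Equality of degrees then excludes that exactly one of the monomials has an inner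
    variable, and leaves [a = a'] and [b = b']; the two inner vectors are comparable only if they
    are equal. *)
Lemma smon_antichain a b i a' b' i' :
  mdeg (smon a b i) = mdeg (smon a' b' i') ->
  (expo c (smon a b i) <= expo c (smon a' b' i'))%MM -> [/\ a = a', b = b' & i = i'].
Proof.
rewrite !mdeg_smon => dE /mnm_lepP le.
have {le} [lex ley] := (le x0, le x1).
rewrite /smon !expoD !expoMn !expoU !mnmDE !mulmnE c_first c_last in lex ley.
rewrite !mul0n in lex ley; rewrite !addn0 !add0n in lex ley.
have eE (k : 'I_n.+1) q : expo c (emon k) q =
    if k == ord0 then 0%N else c (widen_ord (leqnSn n.+1) k) q.
  by rewrite /emon; case: eqP => _; rewrite ?expo0 ?mnm0E ?expoU.
rewrite !{}eE in lex ley.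
set w := widen_ord _ in lex ley.
have wx (k : 'I_n.+1) : (0 < c (w k) x0)%N.
  by have := @c_xdecr (w k) ord_max (ltn_ord k); rewrite c_last.
have wy (k : 'I_n.+1) : (c (w k) x1 < c ord_max x1)%N by rewrite c_yincr //= ltn_ord.
have wk0 (k : 'I_n.+1) : k != ord0 -> ((ord0 : 'I_n.+2) < w k)%N.
  by rewrite -val_eqE /= -lt0n.
have wx' (k : 'I_n.+1) : k != ord0 -> (c (w k) x0 < c ord0 x0)%N.
  by move=> /wk0; exact: c_xdecr.
have wy' (k : 'I_n.+1) : k != ord0 -> (0 < c (w k) x1)%N.
  by move=> /wk0/c_yincr; rewrite c_first.
have mono (k k' : 'I_n.+1) : (k < k')%N ->
  (c (w k') x0 < c (w k) x0)%N /\ (c (w k) x1 < c (w k') x1)%N.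
  by move=> ltk; split; [exact: c_xdecr|exact: c_yincr].
have := (wx i, wx i', wy i, wy i', wx' i, wx' i', wy' i, wy' i', mono i i', mono i' i).
case=> [[[[[[[[[h1 h2] h3] h4] h5] h6] h7] h8] h9] h10].
move: h5 h6 h7 h8 dE lex ley.
case: (eqVneq i ord0) => [i0|i0]; case: (eqVneq i' ord0) => [i0'|i0'] /=.
- move=> _ _ _ _; rewrite !addn0 !add0n i0 i0' => dE lex ley.
  have Y0 : (0 < c ord_max x1)%N by exact: leq_ltn_trans h3.
  have X0 : (0 < c ord0 x0)%N by have := @c_xdecr ord0 ord_max isT; rewrite c_last.
  move: lex ley; rewrite !leq_pmul2l //; split=> //; lia.
- move=> _ /(_ isT) k1 _ /(_ isT) k2 dE lex ley.
  have lt_ba : (b <= b')%N by nia.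
  exfalso; nia.
- move=> /(_ isT) k1 _ /(_ isT) k2 _ dE lex ley.
  have ltaa : (a < a')%N by nia.
  have ltbb : (b < b')%N by nia.
  by exfalso; lia.
- move=> /(_ isT) k1 /(_ isT) k2 /(_ isT) k3 /(_ isT) k4 dE lex ley.
  have eb : b = b' by nia.
  have ea : a = a' by lia.
  split=> //; subst b' a'; apply: val_inj => /=.
  have [/h9|/h10|//] := ltngtP i i'; lia.
Qed.

End Staircase.

(** * Exchanging two inner variables for their outer neighbours *)

Section Exchange.
Context {n : nat} (c : 'I_n.+2 -> 'X_{1..2}).
Implicit Types h i k : 'I_n.+2.

(** The rewriting step from z_i z_i' to z_h z_h'. As a relation on ordinals it includes the
    existence of both neighbours. *)
Definition exchange h i i' h' : Prop :=
  [/\ i = h.+1 :> nat, (i <= i')%N & h' = i'.+1 :> nat].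

Lemma inner_exchange i i' : inner i -> inner i' -> (i <= i')%N ->
  exists h h', exchange h i i' h'.
Proof.
move=> /andP[i0 _] /andP[_ i'n] lei.
have ltp : (i.-1 < n.+2)%N by rewrite (leq_ltn_trans (leq_pred _)).
by exists (Ordinal ltp), (Ordinal i'n); split=> //=; rewrite prednK.
Qed.

Lemma exchange_inner h i i' h' : exchange h i i' h' -> inner i /\ inner i'.
Proof.
case=> ei lei eh'; have := ltn_ord h'; rewrite /inner ei eh'; move: lei; rewrite ei => lei lti.
by rewrite lti (leq_trans _ lei) // (leq_ltn_trans _ lti).
Qed.

(** The function i (n + 1 - i) is strictly concave, so moving two indices apart lowers the sum. This
    makes the rewriting terminate. *)
Lemma exchange_measure h i i' h' : exchange h i i' h' ->
  (h * (n.+1 - h) + h' * (n.+1 - h') < i * (n.+1 - i) + i' * (n.+1 - i'))%N.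
Proof.
case=> ei lei eh'; have lth' := ltn_ord h'; rewrite ei eh' in lei lth' *.
have [d e1] : exists d, nat_of_ord i' = (h.+1 + d)%N by exists (i' - h.+1)%N; lia.
have [p ep] : exists p, n = (i' + p)%N by exists (n - i')%N; lia.
have -> : (n.+1 - h = d + p + 2)%N by lia.
have -> : (n.+1 - i'.+1 = p)%N by lia.
have -> : (n.+1 - h.+1 = d + p + 1)%N by lia.
have -> : (n.+1 - i' = p.+1)%N by lia.
by rewrite e1; nia.
Qed.

(** The last variable with different exponents is z_h', and its exponent is larger in the new
    monomial. *)
Lemma exchange_grevlex h i i' h' r : exchange h i i' h' ->
  grevlex_lt (U_(h) + U_(h') + r)%MM (U_(i) + U_(i') + r)%MM.
Proof.
case=> ei lei eh'; rewrite /grevlex_lt !mdegD !mdeg1 eqxx /=; apply/orP; right.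
apply/existsP; exists h'; rewrite !mnmDE !mnm1E eqxx.
have ne (a b : 'I_n.+2) : (a < b)%N -> (a == b) = false.
  by move=> ltab; rewrite -val_eqE ltn_eqF.
apply/andP; split.
  by rewrite (ne i) ?(ne i') ?(ne h) //; lia.
apply/forallP => k; apply/implyP => ltk.
by rewrite !mnmDE !mnm1E (ne i) ?(ne i') ?(ne h) ?(ne h') //; lia.
Qed.

(** A telescoping sum; the concavity hypothesis makes the truncated subtractions exact. *)
Lemma second_difference_sum (f : nat -> nat) (p d : nat) :
  (forall q, (p <= q <= p + d)%N -> (f q.-1 + f q.+1 <= f q * 2)%N) ->
  (f p + f (p + d) = f p.-1 + f (p + d).+1 +
     \sum_(p <= q < (p + d).+1) (f q * 2 - (f q.-1 + f q.+1)))%N.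
Proof.
elim: d => [|d IHd] conc.
  have := conc p; rewrite addn0 !leqnn => /(_ isT) cp.
  by rewrite big_nat1; lia.
have := conc (p + d.+1)%N; rewrite leqnn leq_addr /= => /(_ isT).
rewrite !addnS /= big_nat_recr /=; last by rewrite leqW // leq_addr.
have /IHd : forall q, (p <= q <= p + d)%N -> (f q.-1 + f q.+1 <= f q * 2)%N.
  by move=> q hq; apply: conc; lia.
set S := (\sum_(_ <= q < _) _)%N; lia.
Qed.

Hypothesis c_concave : concave c.

Let f (q : 'I_2) (p : nat) := c (inord p) q.

Lemma concave_coord q p : (0 < p < n.+1)%N -> (f q p.-1 + f q p.+1 <= f q p * 2)%N.
Proof.
move=> /andP[p0 ltp]; have := @c_concave (inord p.-1) (inord p) (inord p.+1).
rewrite !inordK ?prednK //; try lia.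
by move=> /(_ erefl erefl) /mnm_lepP /(_ q); rewrite mnmDE mulmnE.
Qed.

Lemma exchange_sum h i i' h' q : exchange h i i' h' ->
  (c i q + c i' q = c h q + c h' q +
    \sum_(i <= p < i'.+1) (f q p * 2 - (f q p.-1 + f q p.+1)))%N.
Proof.
case=> ei lei eh'; have lth' := ltn_ord h'.
have fE k p : k = p :> nat -> c k q = f q p by move=> <-; rewrite /f inord_val.
rewrite (fE i i) // (fE i' i') // (fE h i.-1) ?ei // (fE h' i'.+1) // -ei.
have := @second_difference_sum (f q) i (i' - i); rewrite subnKC //; apply.
by move=> p hp; apply: concave_coord; lia.
Qed.

Lemma exchange_le h i i' h' : exchange h i i' h' -> (c h + c h' <= c i + c i')%MM.
Proof.
by move=> ex; apply/mnm_lepP => q; rewrite !mnmDE (exchange_sum q ex) leq_addr.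
Qed.

Lemma cornerN (i : 'I_n.+2) q : inner i -> ~ corner c i ->
  (f q i * 2 = f q i.-1 + f q i.+1)%N.
Proof.
move=> ini nci; apply: contrapT => ne; apply: nci; apply: Or33.
move: (ini) => /andP[i0 lti].
have ltp : (i.-1 < n.+2)%N by lia.
exists (inord i.-1), (inord i.+1); rewrite (inordK ltp) (inordK lti) prednK //; split=> //.
rewrite /mnm_lt c_concave ?(inordK ltp) ?(inordK lti) ?prednK //=.
apply/eqP => /mnmP/(_ q); rewrite mnmDE mulmnE => e; apply: ne.
by rewrite /f inord_val.
Qed.

Lemma exchange_eq h i i' h' : exchange h i i' h' ->
  (forall k, (i <= k <= i')%N -> ~ corner c k) -> (c h + c h')%MM = (c i + c i')%MM.
Proof.
move=> ex nc; have [/andP[i0 _] /andP[_ i'n]] := exchange_inner ex.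
apply/mnmP => q; rewrite !mnmDE (exchange_sum q ex) big_nat_cond big1 ?addn0 // => p.
rewrite andbT => hp; have ltp : (p < n.+2)%N by lia.
have := @cornerN (Ordinal ltp) q; rewrite /inner /= => -> //; first by rewrite subnn.
- by lia.
- by apply: nc; rewrite /=; lia.
Qed.

(** Equality would make all second differences between [i] and [i'] vanish in both coordinates, in
    particular those at the corner [k]. *)
Lemma exchange_lt h i i' h' k : exchange h i i' h' -> (i <= k <= i')%N -> corner c k ->
  mnm_lt (c h + c h')%MM (c i + c i')%MM.
Proof.
move=> ex hk; rewrite /mnm_lt (exchange_le ex) /=.
have [/andP[i0 _] /andP[_ i'n]] := exchange_inner ex.
case=> [k0|kn|[a [b [ka bk /andP[_ ne]]]]]; first by exfalso; lia.
  by exfalso; lia.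
apply: contra ne => /eqP/mnmP e; apply/eqP/mnmP => q.
rewrite mulmnE; have := e q; rewrite !mnmDE (exchange_sum q ex) => /eqP.
rewrite -{1}[(c h q + c h' q)%N]addn0 eqn_add2l eq_sym sum_nat_seq_eq0 => /allP/(_ k).
rewrite mem_index_iota ltnS => /(_ hk) /=; rewrite /f inord_val.
have -> : inord k.-1 = a by apply: val_inj; rewrite /= ka inordK //; lia.
have -> : inord k.+1 = b by apply: val_inj; rewrite /= inordK ?bk //; lia.
have := concave_coord q (p := k).
rewrite /f inord_val.
have -> : inord k.-1 = a by apply: val_inj; rewrite /= ka inordK //; lia.
have -> : inord k.+1 = b by apply: val_inj; rewrite /= inordK ?bk //; lia.
lia.
Qed.

End Exchange.

(** * The binomials and monomials of the relation ideal *)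

Lemma det_mx22 (R : comNzRingType) (A : 'M[R]_2) :
  \det A = A ord0 ord0 * A ord_max ord_max - A ord0 ord_max * A ord_max ord0.
Proof.
rewrite (expand_det_row _ ord0) !big_ord_recl big_ord0 addr0 /cofactor !det_mx11.
rewrite !mxE /= expr0 expr1 mul1r mulN1r mulrN.
by congr (A _ _ * A _ _ - A _ _ * A _ _); apply: val_inj.
Qed.

Lemma zvar_ord (K : fieldType) (m : nat) (i : 'I_m) : zvar i = 'X_i :> {mpoly K[m]}.
Proof. by rewrite /zvar valK. Qed.

Lemma mnm1_pair_inj n (q q' i i' : 'I_n) : (q <= q')%N -> (i <= i')%N ->
  (U_(q) + U_(q') = U_(i) + U_(i'))%MM -> q = i /\ q' = i'.
Proof.
move=> leq lei e.
have U_inj (u v : 'I_n) : U_(u)%MM = U_(v)%MM -> u = v.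
  by move=> /eqP; rewrite eq_mnm1 => /eqP.
have [eqi|nei] := eqVneq q i.
  by move: e; rewrite eqi => /addmI /U_inj.
have [eqi'|nei'] := eqVneq q i'.
  move: e; rewrite eqi' [RHS]addmC => /addmI /U_inj eq'.
  have ii : i = i' by apply: val_inj => /=; move: leq; rewrite eq' ?eqi'; lia.
  by rewrite eq' ii.
have := congr1 (fun u : 'X_{1..n} => u q) e.
by rewrite !mnmDE !mnm1E eqxx !(eq_sym _ q) (negbTE nei) (negbTE nei').
Qed.

Section Relations.
Context (K : fieldType) (n : nat) (c : 'I_n.+2 -> 'X_{1..2}).
Context (l : nat) (j : 'I_l -> 'I_n.+2).
Hypothesis j_incr : forall k k' : 'I_l, (k < k')%N -> (j k < j k')%N.
Hypothesis j_corner : range j = [set i | corner c i].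
Implicit Types h i : 'I_n.+2.

Let B : set {mpoly K[n.+2]} := binomial_relations j.
Let M := monomial_relations B.

Lemma corner_j (k : 'I_l) : corner c (j k).
Proof. by have : range j (j k) by [exists k]; rewrite j_corner. Qed.

Lemma corner_ex i : corner c i -> exists k, j k = i.
Proof.
by move=> ci; have : [set i | corner c i] i by []; rewrite -j_corner => -[k _ <-]; exists k.
Qed.

Lemma j_lt (k k' : 'I_l) : (j k < j k')%N -> (k < k')%N.
Proof.
move=> ltj; have [//|/j_incr|/val_inj e] := ltngtP k k'; first by lia.
by move: ltj; rewrite e ltnn.
Qed.

(** The minor with columns p < q of the block starting at the corner j_k is the exchange with h =
    j_k + p and i' = j_k + q. The indices from [i] to [i'] then lie strictly between two consecutive
    corners, and conversely. *)
Lemma binomial_relationsE f : B f <-> exists h i i' h',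
  [/\ exchange h i i' h', forall k : 'I_n.+2, (i <= k <= i')%N -> ~ corner c k
    & f = 'X_h * 'X_h' - 'X_i * 'X_i'].
Proof.
split.
  move=> [k [k' [kk' [g [t [gmono tmono ->]]]]]].
  have g0 : g ord0 = 0%N :> nat.
    by have := gmono ord0 ord_max isT; have := ltn_ord (g ord_max); lia.
  have g1 : g ord_max = 1%N :> nat.
    by have := gmono ord0 ord_max isT; have := ltn_ord (g ord_max); lia.
  have := tmono ord0 ord_max isT; have := ltn_ord (t ord_max).
  rewrite det_mx22 !mxE g0 g1 !addn0; move: (nat_of_ord (t _)) => q.
  move: (nat_of_ord (t _)) => p ltq ltpq.
  have ltjk' := ltn_ord (j k').
  have h1 : (j k + p < n.+2)%N by lia.
  have h2 : ((j k + p).+1 < n.+2)%N by lia.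
  have h3 : (j k + q < n.+2)%N by lia.
  have h4 : ((j k + q).+1 < n.+2)%N by lia.
  exists (Ordinal h1), (Ordinal h2), (Ordinal h3), (Ordinal h4); split.
  - by split=> //=; lia.
  - move=> i /= hi /corner_ex[k'' e]; rewrite -e in hi.
    have lt1 : (k < k'')%N by apply: j_lt; lia.
    have lt2 : (k'' < k')%N by apply: j_lt; lia.
    by lia.
  - rewrite -!zvar_ord /= addn1 !addSn; congr (_ - _); exact: mulrC.
move=> [h [i [i' [h' [ex nc ->]]]]]; have [ei lei eh'] := ex.
have [k0 ek0] : exists k0, j k0 = ord0 by apply: corner_ex; apply: Or31.
have [k1 ek1] : exists k1, j k1 = ord_max by apply: corner_ex; apply: Or32.
have lt0i : (j k0 < i)%N by rewrite ek0 ei.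
(* The last corner before [i]. The next one is beyond [i'], since no corner lies between [i] and
   [i']. *)
case: (@arg_maxnP _ k0 (fun k => (j k < i)%N) (fun k => k) lt0i) => k ltk kmax.
have ltkk1 : (k < k1)%N.
  by apply: j_lt; rewrite ek1 /=; have := ltn_ord h'; lia.
have ltk' : (k.+1 < l)%N by exact: leq_ltn_trans (ltn_ord k1).
pose k' := Ordinal ltk'.
have lek' : (i' < j k')%N.
  rewrite ltnNge; apply/negP => le'.
  have [lt'|ge'] := ltnP (j k') i; first by have := kmax _ lt'; rewrite /= ltnn.
  by apply: (nc (j k')); [rewrite ge'|exact: corner_j].
exists k, k'; split=> //.
have p0 : (h - j k < j k' - j k)%N by lia.
have q0 : (i' - j k < j k' - j k)%N by lia.
exists id, (fun r : 'I_2 => if r == ord0 then Ordinal p0 else Ordinal q0); split=> //.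
  move=> x y; case: (x =P ord0) => [->|/eqP x0]; case: (y =P ord0) => [->|/eqP y0] //=; try lia.
  - by move: x0 y0; rewrite -!val_eqE /=; have := ltn_ord x; have := ltn_ord y; lia.
rewrite det_mx22 !mxE /= !addn0 addn1.
have -> : (j k + (h - j k) = h)%N by lia.
have -> : ((j k).+1 + (i' - j k) = h')%N by lia.
have -> : (j k + (i' - j k) = i')%N by lia.
have -> : ((j k).+1 + (h - j k) = i)%N by lia.
by rewrite !zvar_ord; congr (_ - _); exact: mulrC.
Qed.

Lemma initial_exchange h i i' h' : exchange h i i' h' ->
  initial_monomial grevlex_lt ('X_h * 'X_h' - 'X_i * 'X_i' : {mpoly K[n.+2]})
    (U_(i) + U_(i'))%MM.
Proof.
move=> ex; have := exchange_grevlex 0%MM ex; rewrite !addm0 => lt.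
have ne : (U_(h) + U_(h'))%MM != (U_(i) + U_(i'))%MM.
  by apply/eqP => e; move: lt; rewrite e => /grevlex_irr.
rewrite -!mpolyXD; split.
  by rewrite mcoeff_msupp mcoeffB !mcoeffX (negbTE ne) eqxx sub0r oppr_eq0 oner_eq0.
move=> v; rewrite mcoeff_msupp mcoeffB !mcoeffX => + vi.
have [<- _ //|_] := eqVneq (U_(h) + U_(h'))%MM v.
by rewrite eq_sym in vi; rewrite (negbTE vi) subrr eqxx.
Qed.

(** The initial monomial of the binomial of an exchange is z_i z_i', which determines the pair.
    Hence z_i z_i' is not initial exactly when a corner prevents this binomial from being a
    minor. *)
Lemma monomial_relationsE f : M f <-> exists h i i' h' (k : 'I_n.+2),
  [/\ exchange h i i' h', (i <= k <= i')%N, corner c k & f = 'X_i * 'X_i'].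
Proof.
split.
  move=> [i [i' [i0 lei i'n -> ninit]]].
  have [||h [h' ex]] := @inner_exchange n i i' _ _ lei.
  - by rewrite /inner i0 (leq_ltn_trans _ i'n).
  - by rewrite /inner i'n (leq_trans i0).
  exists h, i, i', h'; apply: contrapT => nk.
  apply: (ninit ('X_h * 'X_h' - 'X_i * 'X_i')); last exact: initial_exchange.
  apply/binomial_relationsE; exists h, i, i', h'; split=> // k hk ck.
  by apply: nk; exists k.
move=> [h [i [i' [h' [k [ex hk ck ->]]]]]]; have [ei lei eh'] := ex.
exists i, i'; split=> //; first by rewrite ei.
  by rewrite -eh' ltn_ord.
move=> g /binomial_relationsE[p [q [q' [p' [ex' nc ->]]]]].
move=> /(initial_monomial_uniq (initial_exchange ex')).
have [_ leq _] := ex' => e.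
have [eq1 eq2] := mnm1_pair_inj leq lei e.
by apply: (nc k) => //; rewrite eq1 eq2.
Qed.

End Relations.

(** * Reduction to standard monomials and the initial ideal *)

Section Reduction.
Context (K : fieldType) (n : nat) (c : 'I_n.+2 -> 'X_{1..2}).
Hypothesis c_concave : concave c.
Context (l : nat) (j : 'I_l -> 'I_n.+2).
Hypothesis j_incr : forall k k' : 'I_l, (k < k')%N -> (j k < j k')%N.
Hypothesis j_corner : range j = [set i | corner c i].

Let B : set {mpoly K[n.+2]} := binomial_relations j.
Let M := monomial_relations B.
Let L0 := ideal_gen (B `|` M).
Let HL0 : is_ideal L0 := ideal_gen_ideal _.

Lemma nonstd_split (w : 'X_{1..n.+2}) : ~~ std w -> exists i i' r,
  [/\ inner i, inner i', (i <= i')%N & w = (U_(i) + U_(i') + r)%MM].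
Proof.
rewrite /std -ltnNge => ltw.
have [|i fi iw] := @lweight_gt0 _ (fun i => inner i) w; first exact: ltnW.
rewrite lt0b in fi; have e := submK iw; move: ltw; rewrite -{1}e lweightD lweightU fi addn1 ltnS.
move=> /lweight_gt0[i' fi' iw']; rewrite lt0b in fi'; have e' := submK iw'.
set r := (_ - _ - _)%MM in e'.
have {e e'} ew : w = (U_(i) + U_(i') + r)%MM.
  by rewrite -[LHS]e -e' addmC (addmC r) addmA.
have [lei|/ltnW lei] := leqP i i'; first by exists i, i', r.
by exists i', i, r; rewrite [(U_(i') + _)%MM]addmC.
Qed.

(** Repeated exchanges, terminating by [exchange_measure]. The standard monomial [w'] and the bound
    on its exponent are kept even when ['X_[w]] lies in [L0]: the linear independence of the
    standard monomials depends on them. *)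
Lemma reduction w : exists w', [/\ std w', mdeg w' = mdeg w, (expo c w' <= expo c w)%MM &
  L0 'X_[w] \/ (L0 ('X_[w] - 'X_[w']) /\ (w' = w \/ grevlex_lt w' w))].
Proof.
pose mu := lweight (fun i : 'I_n.+2 => (i * (n.+1 - i))%N).
have [d] := ubnP (mu w); elim: d w => // d IHd w ltd.
have [sw|/nonstd_split[i [i' [r [ini ini' lei ew]]]]] := boolP (std w).
  exists w; split=> //; first exact: lepm_refl.
  by right; rewrite subrr; split; [exact: (is_ideal0 HL0)|left].
have [h [h' ex]] := inner_exchange ini ini' lei.
have [|w' [sw' dw' ew' Hw']] := IHd (U_(h) + U_(h') + r)%MM.
  have := exchange_measure ex; move: ltd; rewrite ew /mu !lweightD !lweightU; lia.
exists w'; split=> //.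
- by rewrite dw' ew !mdegD !mdeg1.
- apply: lepm_trans ew' _; rewrite ew !expoD !expoU; apply/mnm_lepP => q.
  by rewrite ![(_ + expo c r)%MM q]mnmDE leq_add2r; apply/mnm_lepP; exact: exchange_le.
have [[k [hk ck]]|nc] := pselect (exists k : 'I_n.+2, (i <= k <= i')%N /\ corner c k).
  left; rewrite ew mpolyXD; apply: (is_idealMr _ HL0); rewrite mpolyXD.
  apply: sub_ideal_gen; right; apply/(monomial_relationsE j_incr j_corner).
  by exists h, i, i', h', k.
have bin : L0 ('X_[w] - 'X_[U_(h) + U_(h') + r]).
  rewrite ew !mpolyXD -mulrBl; apply: (is_idealMr _ HL0).
  rewrite -opprB; apply: (is_idealN HL0).
  apply: sub_ideal_gen; left; apply/(binomial_relationsE j_incr j_corner).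
  by exists h, i, i', h'; split=> // k hk ck; apply: nc; exists k.
case: Hw' => [Lw1|[Lw1 ltw1]]; first by left; apply: (is_ideal_shift HL0) Lw1.
right; split.
  by rewrite -[_ - _](subrKA 'X_[U_(h) + U_(h') + r]); exact: (is_idealD HL0).
right; have := exchange_grevlex r ex; rewrite -ew => lt.
by case: ltw1 => [->//|ltw1]; exact: grevlex_trans lt.
Qed.

Lemma normal_form v : exists rho : {mpoly K[n.+2]}, L0 ('X_[v] - rho) /\
  (rho = 0 \/ exists v', [/\ std v', mdeg v' = mdeg v, rho = 'X_[v'] &
     v' = v \/ grevlex_lt v' v]).
Proof.
have [v' [sv' dv' _ [Lv|[Lv ltv]]]] := reduction v.
  by exists 0; rewrite subr0; split=> //; left.
by exists 'X_[v']; split=> //; right; exists v'.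
Qed.

Section StandardBasis.
Variable L : set {mpoly K[n.+2]}.
Hypothesis L_ideal : is_ideal L.
Hypothesis L_std : forall g, L g -> (forall v, v \in msupp g -> std v) -> g = 0.
Hypothesis BL : B `<=` L.
Hypothesis ML : M `<=` L.

Lemma L0_sub : L0 `<=` L.
Proof. by apply: ideal_gen_min => // f [/BL|/ML]. Qed.

(** Replacing each monomial of [f] by its normal form changes [f] by an element of [L0]. The result
    lies in [L] and involves standard monomials only, so it is 0. *)
Lemma sum_normal_form (f : {mpoly K[n.+2]}) : L f ->
  exists rho : 'X_{1..n.+2} -> {mpoly K[n.+2]},
  [/\ forall v, rho v = 0 \/ exists v', rho v = 'X_[v'] /\ (v' = v \/ grevlex_lt v' v),
      forall v, std v -> rho v = 'X_[v],
      \sum_(v <- msupp f) f@_v *: rho v = 0 & L0 f].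
Proof.
move=> Lf; have /choice[rho Hrho] (v : 'X_{1..n.+2}) : exists rho : {mpoly K[n.+2]},
    [/\ L0 ('X_[v] - rho),
    (rho = 0 \/ exists v', [/\ std v', rho = 'X_[v'] & v' = v \/ grevlex_lt v' v]) &
    std v -> rho = 'X_[v]].
  have [sv|nsv] := boolP (std v).
    exists 'X_[v]; rewrite subrr; split=> //; first exact: (is_ideal0 HL0).
    by right; exists v; split=> //; left.
  have [rho [Lr Hr]] := normal_form v; exists rho; split=> //.
  by case: Hr => [|[v' [sv' _ er ltv]]]; [left|right; exists v'].
pose g := \sum_(v <- msupp f) f@_v *: rho v.
have L0fg : L0 (f - g).
  rewrite {1}(mpolyE f) -sumrB; apply: (is_ideal_sum _ HL0) => v.
  by rewrite -scalerBr -mul_mpolyC; apply: (is_idealMl _ HL0); have [] := Hrho v.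
have g0 : g = 0.
  apply: L_std.
    by rewrite -[g](subKr f); apply: is_idealB => //; exact: L0_sub.
  move=> u; rewrite mcoeff_msupp raddf_sum /=; apply: contraNT => nsu.
  rewrite big1 // => v _; rewrite mcoeffZ.
  have [_ [->|[v' [sv' -> _]]] _] := Hrho v; first by rewrite mcoeff0 mulr0.
  rewrite mcoeffX; case: eqP => [e|_]; last by rewrite mulr0.
  by rewrite -e sv' in nsu.
exists rho; split=> //; last by rewrite -[f]subr0 -g0.
  move=> v; have [_ [->|[v' [_ -> ltv]]] _] := Hrho v; [by left|by right; exists v'].
by move=> v sv; have [_ _] := Hrho v; apply.
Qed.

Lemma relations_eq : L0 = L.
Proof.
apply/seteqP; split; first exact: L0_sub.
by move=> f /sum_normal_form[rho []].
Qed.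

(** If [u] were standard, it would be its own normal form, while those of the other monomials of [f]
    are 0 or smaller than [u]. The coefficient of [u] would survive in the vanishing sum of normal
    forms. *)
Lemma initial_nonstd f u : L0 f -> initial_monomial grevlex_lt f u -> ~~ std u.
Proof.
move=> /L0_sub/sum_normal_form[rho [rhoE rho_std f0 _]] [fu lt_u].
apply/negP => su; move: (fu); rewrite mcoeff_msupp => /eqP; apply.
have := congr1 (mcoeff u) f0; rewrite raddf_sum /= (bigD1_seq u) ?msupp_uniq //=.
rewrite mcoeffZ rho_std // mcoeffX eqxx mulr1 mcoeff0 big_seq_cond big1 ?addr0 //.
move=> v /andP[fv vu]; rewrite mcoeffZ.
have [->|[v' [-> lev]]] := rhoE v; first by rewrite mcoeff0 mulr0.
rewrite mcoeffX; case: eqP => [e|_]; last by rewrite mulr0.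
have lt_vu := lt_u _ fv vu; case: lev => [ev|lt_uv].
  by case/eqP: vu; rewrite -ev e.
by case: (@grevlex_irr _ u); apply: grevlex_trans lt_vu; rewrite -{1}e.
Qed.

Lemma initial_ideal_L0 :
  initial_ideal grevlex_lt L0 = ideal_pow (@inner_variables_ideal K n.+2) 2.
Proof.
have HI : is_ideal (@inner_variables_ideal K n.+2) by exact: ideal_gen_ideal.
have HN : is_ideal (initial_ideal grevlex_lt L0) by exact: ideal_gen_ideal.
have HP := ideal_pow_ideal (@inner_variables_ideal K n.+2) 2.
apply/seteqP; split.
  apply: ideal_gen_min => // _ [u [-> [g L0g /(initial_nonstd L0g)]]].
  move=> /nonstd_split[i [i' [r [ini ini' _ ->]]]].
  rewrite mpolyXD; apply: (is_idealMr _ HP); rewrite mpolyXD.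
  have Xi k : inner k -> @inner_variables_ideal K n.+2 'X_k.
    by move=> ink; apply: sub_ideal_gen; exists k.
  apply: sub_ideal_gen; exists 'X_i; last by exists 'X_i' => //; exact: Xi.
  by rewrite -['X_i]mul1r; apply: sub_ideal_gen; exists 1 => //; exists 'X_i; first exact: Xi.
(* A product of inner variables is itself a monomial relation if a corner lies between them, and the
   initial monomial of a binomial relation otherwise. *)
have XX i i' : inner i -> inner i' -> (i <= i')%N ->
    initial_ideal grevlex_lt L0 ('X_i * 'X_i').
  move=> ini ini' lei; have [h [h' ex]] := inner_exchange ini ini' lei.
  apply: sub_ideal_gen; exists (U_(i) + U_(i'))%MM; rewrite mpolyXD; split=> //.
  have [[k [hk ck]]|nc] := pselect (exists k : 'I_n.+2, (i <= k <= i')%N /\ corner c k).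
    exists 'X_[U_(i) + U_(i')].
      rewrite mpolyXD; apply: sub_ideal_gen; right.
      by apply/(monomial_relationsE j_incr j_corner); exists h, i, i', h', k.
    by rewrite /initial_monomial msuppX; split=> [|v]; rewrite inE // => /eqP ->; rewrite eqxx.
  exists ('X_h * 'X_h' - 'X_i * 'X_i'); last exact: initial_exchange.
  apply: sub_ideal_gen; left; apply/(binomial_relationsE j_incr j_corner).
  by exists h, i, i', h'; split=> // k hk ck; apply: nc; exists k.
apply: ideal_gen_min => // _ [a Ha [b Hb <-]].
(* The first factor is given in the first power of the ideal, which is contained in the ideal. *)
have {}Ha : @inner_variables_ideal K n.+2 a.
  by apply: (ideal_gen_min HI _ Ha) => _ [a' _ [b' Hb' <-]]; exact: (is_idealMl _ HI).
apply: (@ideal_gen_min _ _ [set a | initial_ideal grevlex_lt L0 (a * b)] _ _ _ Ha).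
  split=> /=; first by rewrite mul0r; exact: is_ideal0.
  by move=> r u v; rewrite mulrDl -mulrA; case: HN => _; apply.
move=> _ [i ini <-] /=.
apply: (@ideal_gen_min _ _ [set b | initial_ideal grevlex_lt L0 ('X_i * b)] _ _ _ Hb).
  split=> /=; first by rewrite mulr0; exact: is_ideal0.
  by move=> r u v; rewrite mulrDr mulrCA; case: HN => _; apply.
move=> _ [i' ini' <-] /=; have [lei|/ltnW lei] := leqP i i'; first exact: XX.
by rewrite mulrC; exact: XX.
Qed.

End StandardBasis.
End Reduction.

(** * Fiber cones of monomial ideals *)

Section FiberCone.
Context (K : fieldType) (q : nat) (I : set {mpoly K[q]}).
Context (m : nat) (c : 'I_m -> 'X_{1..q}).
Hypothesis I_gen : I = ideal_gen [set 'X_[u] | u in range c].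

Let A := fiber_cone I.
Let pi : {rmorphism rees I -> A} := @rees_to_fiber K q I.

Lemma rees_to_fiber_eq0 p : pi p = 0 <-> max_ideal_rees p.
Proof.
rewrite /pi -(rmorph0 (@rees_to_fiber K q I)) /= /rees_to_fiber; split.
  by move/eqP; rewrite -Quotient.idealrBE subr0 => /asboolP.
by move=> h; apply/eqP; rewrite -Quotient.idealrBE subr0; apply/asboolP.
Qed.

Lemma max_ideal_coef0 (f : {mpoly K[q]}) : f@_0%MM = 0 -> max_ideal f.
Proof.
move=> f0; have Hm := ideal_gen_ideal [set ('X_i : {mpoly K[q]}) | i in setT].
rewrite (mpolyE f) big_seq; apply: (is_ideal_sum_in _ Hm) => v fv.
rewrite -mul_mpolyC; apply: (is_idealMl _ Hm).
have v0 : v != 0%MM by apply: contraTneq fv => ->; rewrite mcoeff_msupp f0 eqxx.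
have [i vi] : exists i, v i != 0%N.
  apply: contrapT => nex; case/eqP: v0; apply/mnmP => i; rewrite mnm0E.
  by apply: contrapT => /eqP vi; apply: nex; exists i.
rewrite -lep1mP in vi; rewrite -(submK vi) mpolyXD; apply: (is_idealMl _ Hm).
by apply: sub_ideal_gen; exists i.
Qed.

Lemma fiber_const_rees (a : {mpoly K[q]}) : pi (rees_const I a) = fiber_const I a@_0%MM.
Proof.
apply/eqP; rewrite -subr_eq0 /= -rmorphB -rmorphB; apply/eqP/rees_to_fiber_eq0.
apply: sub_ideal_gen; exists (a - (a@_0%MM)%:MP) => //.
by apply: max_ideal_coef0; rewrite mcoeffB mcoeffC eqxx mulr1 subrr.
Qed.

(** The element f t^k of the Rees ring, with default value 0 when [f] is not in I^k. *)
Definition hrees (k : nat) (f : {mpoly K[q]}) : rees I := insubd (0 : rees I) (f *: 'X^k).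

Lemma hrees_val k f : ideal_pow I k f -> rees_val (hrees k f) = f *: 'X^k.
Proof.
move=> If; rewrite /hrees -[LHS]/(val (insubd _ _)) val_insubd ifT //.
apply/asboolP => i; rewrite coefZ coefXn; case: eqP => [->|_]; first by rewrite mulr1.
by rewrite mulr0; exact: (is_ideal0 (ideal_pow_ideal I i)).
Qed.

Lemma rees_coef (p : rees I) k : ideal_pow I k (rees_val p)`_k.
Proof. by case: p => p /= /asboolP. Qed.

Lemma ideal_pow1 u : I u -> ideal_pow I 1 u.
Proof. by move=> Iu; apply: sub_ideal_gen; exists 1 => //; exists u; rewrite ?mul1r. Qed.

Lemma I_c i : I 'X_[c i].
Proof. by rewrite I_gen; apply: sub_ideal_gen; exists (c i) => //; exists i. Qed.

Let HI : is_ideal I. Proof. rewrite I_gen; exact: ideal_gen_ideal. Qed.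

Let rho i : rees I := rees_deg1 I 'X_[c i].
Let z i : A := pi (rho i).
Let psi : {rmorphism {mpoly K[m]} -> A} := mmap (fiber_const I) z.

Lemma rho_val i : rees_val (rho i) = 'X_[c i] *: 'X.
Proof. exact: (@hrees_val 1 'X_[c i] (ideal_pow1 (I_c i))). Qed.

Lemma psiC a : psi a%:MP = fiber_const I a.
Proof. exact: mmapC. Qed.

Lemma psiXU i : psi 'X_i = z i.
Proof. by rewrite /psi /= mmapX mmap1U. Qed.

Lemma psiZ a f : psi (a *: f) = fiber_const I a * psi f.
Proof. exact: mmapZ. Qed.

(** Both claims are read off the product [p] in the Rees ring of the elements u_i t. *)
Lemma ideal_pow_expo w : ideal_pow I (mdeg w) 'X_[expo c w] /\
  psi 'X_[w] = pi (hrees (mdeg w) 'X_[expo c w]).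
Proof.
pose p := \prod_i rho i ^+ w i.
have pE : rees_val p = 'X_[expo c w] *: 'X^(mdeg w).
  rewrite /p -[LHS]/(val _) rmorph_prod.
  under eq_bigr => i _ do rewrite rmorphXn /= rho_val exprZn.
  rewrite scaler_prod mdegE expr_sum; congr (_ *: _).
  by rewrite mprodXnE.
have Ie : ideal_pow I (mdeg w) 'X_[expo c w].
  by have := rees_coef p (mdeg w); rewrite pE coefZ coefXn eqxx mulr1.
split=> //; rewrite /psi /= mmapX /mmap1.
have -> : hrees (mdeg w) 'X_[expo c w] = p by apply: val_inj; rewrite /= hrees_val.
by rewrite /p rmorph_prod; apply: eq_bigr => i _; rewrite rmorphXn.
Qed.

Lemma hreesM k (a u : {mpoly K[q]}) : ideal_pow I k u ->
  hrees k (a * u) = rees_const I a * hrees k u.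
Proof.
move=> Iu; apply: val_inj; rewrite rmorphM /= !hrees_val //.
  by rewrite mul_polyC scalerA.
exact: (is_idealMl _ (ideal_pow_ideal I k)).
Qed.

Lemma hreesD k u v : ideal_pow I k u -> ideal_pow I k v ->
  hrees k (u + v) = hrees k u + hrees k v.
Proof.
move=> Iu Iv; apply: val_inj; rewrite rmorphD /= !hrees_val // ?scalerDl //.
exact: (is_idealD (ideal_pow_ideal I k)).
Qed.

Lemma hreesS k u i : ideal_pow I k u -> hrees k.+1 (u * 'X_[c i]) = hrees k u * rho i.
Proof.
move=> Iu; apply: val_inj; rewrite rmorphM /= !hrees_val //.
  by rewrite rho_val -scalerAl -scalerAr scalerA exprSr.
apply: sub_ideal_gen; exists u => //; exists 'X_[c i] => //; exact: I_c.
Qed.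

(* Stability under K suffices: a polynomial acts on the fiber cone through its
   constant term. *)
Lemma hrees_ind k (P : set A) :
  P 0 -> (forall a u v, P u -> P v -> P (fiber_const I a * u + v)) ->
  (forall u i, ideal_pow I k u -> P (pi (hrees k u) * z i)) ->
  forall f, ideal_pow I k.+1 f -> P (pi (hrees k.+1 f)).
Proof.
move=> P0 PD Pz f If.
have Hk := ideal_pow_ideal I k; have Hk1 := ideal_pow_ideal I k.+1.
have hrees0 : hrees k.+1 0 = 0.
  by apply: val_inj; rewrite /= hrees_val ?scale0r //; exact: (is_ideal0 Hk1).
suff [] : [set f | ideal_pow I k.+1 f /\ P (pi (hrees k.+1 f))] f by [].
apply: (ideal_gen_min _ _ If); first split => /=.
- by rewrite hrees0 rmorph0; split=> //; exact: (is_ideal0 Hk1).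
- move=> a u v [Iu Pu] [Iv Pv]; have Iau := is_idealMl a Hk1 Iu.
  split; first exact: (is_idealD Hk1).
  by rewrite hreesD // hreesM // rmorphD rmorphM fiber_const_rees; exact: PD.
move=> _ [a Ia [b Ib <-]].
have Iab u : I u -> ideal_pow I k.+1 (a * u).
  by move=> Iu; apply: sub_ideal_gen; exists a => //; exists u.
suff [] : [set b | I b /\ P (pi (hrees k.+1 (a * b)))] b by split=> //; exact: Iab.
move: Ib; rewrite {1}I_gen; apply: ideal_gen_min; first split => /=.
- by rewrite mulr0 hrees0 rmorph0; split=> //; exact: (is_ideal0 HI).
- move=> r u v [Iu Pu] [Iv Pv]; have Iru := is_idealMl r HI Iu.
  split; first exact: (is_idealD HI).
  rewrite mulrDr hreesD; [|exact: Iab|exact: Iab].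
  rewrite mulrCA hreesM; last exact: Iab.
  by rewrite rmorphD rmorphM fiber_const_rees; exact: PD.
move=> _ [_ [i _ <-] <-] /=; split; first exact: I_c.
by rewrite hreesS // rmorphM; exact: Pz.
Qed.

Lemma psi_surj a : exists g, psi g = a.
Proof.
have hsurj k f : ideal_pow I k f -> exists g, psi g = pi (hrees k f).
  elim: k f => [|k IHk] f If.
    exists (f@_0%MM)%:MP; rewrite psiC -fiber_const_rees; congr (pi _).
    by apply: val_inj; rewrite /= hrees_val // -mul_polyC mulr1.
  apply: (hrees_ind (P := [set a | exists g, psi g = a])) If => /=.
  - by exists 0; rewrite rmorph0.
  - by move=> r _ _ [g <-] [g' <-]; exists (r *: g + g'); rewrite rmorphD psiZ.
  - by move=> u i /IHk[g <-]; exists (g * 'X_i); rewrite rmorphM psiXU.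
have [p ->] : exists p, a = pi p.
  by exists (generic_quotient.repr a); rewrite /pi /= /rees_to_fiber generic_quotient.reprK.
have -> : p = \sum_(k < size (rees_val p)) hrees k (rees_val p)`_k.
  apply: val_inj; rewrite /= -[RHS]/(val _) rmorph_sum /= -[LHS]coefK poly_def.
  by apply: eq_bigr => k _; rewrite hrees_val //; exact: rees_coef.
rewrite rmorph_sum; apply: (big_ind (fun a => exists g, psi g = a)).
- by exists 0; rewrite rmorph0.
- by move=> _ _ [g <-] [g' <-]; exists (g + g'); rewrite rmorphD.
- by move=> k _; apply: hsurj; exact: rees_coef.
Qed.

Definition dominated k (u : 'X_{1..q}) := exists2 w : 'X_{1..m}, mdeg w = k & (expo c w <= u)%MM.

Lemma ideal_pow_dominated k f : ideal_pow I k f ->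
  forall u, u \in msupp f -> dominated k u.
Proof.
have lemD (a b a' b' : 'X_{1..q}) : (a <= b -> a' <= b' -> a + a' <= b + b')%MM.
  move=> /mnm_lepP ab /mnm_lepP ab'; apply/mnm_lepP => i.
  by rewrite !mnmDE leq_add.
have idom d : is_ideal [set f : {mpoly K[q]} | forall u, u \in msupp f -> dominated d u].
  split=> /=; first by move=> u; rewrite msupp0.
  move=> a f1 f2 H1 H2 u /msuppD_le; rewrite mem_cat => /orP[/msuppM_le|/H2//].
  case/allpairsP => -[u1 u2] /= [_ /H1[w dw ew] ->]; exists w => //.
  exact: lepm_trans ew (lem_addl _ _).
elim: k f => [|k IHk] f If.
  by move=> u _; exists 0%MM; rewrite ?mdeg0 // expo0; apply/mnm_lepP => i; rewrite mnm0E.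
apply: (ideal_gen_min (idom k.+1) _ If) => _ [a Ia [b Ib <-]] u /msuppM_le.
case/allpairsP => -[u1 u2] /= [/(IHk _ Ia)[w dw ew] fu2 ->].
have : dominated 1 u2.
  move: Ib u2 fu2; rewrite I_gen; apply: (ideal_gen_min (idom 1%N)) => _ [_ [i _ <-] <-] /= v.
  by rewrite msuppX inE => /eqP ->; exists U_(i)%MM; rewrite ?mdeg1 // expoU lepm_refl.
move=> [w' dw' ew']; exists (w + w')%MM; first by rewrite mdegD dw dw' addn1.
by rewrite expoD; exact: lemD.
Qed.

(** Polynomials in the maximal ideal have no constant term, so their exponents strictly exceed the
    empty sum of generators; strictness persists under multiplication by the Rees ring, by
    [ideal_pow_dominated]. *)
Lemma max_ideal_rees_dominated (p : rees I) : max_ideal_rees p ->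
  forall k u, u \in msupp (rees_val p)`_k ->
    exists2 w : 'X_{1..m}, mdeg w = k & mnm_lt (expo c w) u.
Proof.
move=> mp; pose S : set (rees I) := [set p | forall k u, u \in msupp (rees_val p)`_k ->
    exists2 w : 'X_{1..m}, mdeg w = k & mnm_lt (expo c w) u].
suff : S p by [].
apply: (ideal_gen_min _ _ mp); first split.
- by move=> k u; rewrite /= coef0 msupp0.
- move=> a f1 f2 H1 H2 k u; rewrite /= coefD => /msuppD_le.
  rewrite mem_cat => /orP[|/H2//].
  rewrite coefM => /msupp_sum_le /flattenP[_ /mapP[i _ ->] /msuppM_le].
  case/allpairsP => -[u1 u2] /= [fu1 /H1[w2 dw2 /andP[ew2 new2]] ->].
  have [w1 dw1 ew1] := ideal_pow_dominated (rees_coef a i) fu1.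
  exists (w1 + w2)%MM; first by rewrite mdegD dw1 dw2 subnKC // -ltnS.
  rewrite expoD /mnm_lt; move: ew1 ew2 => /mnm_lepP ew1 /mnm_lepP ew2.
  apply/andP; split; first by apply/mnm_lepP => t; rewrite !mnmDE leq_add.
  apply: contra new2 => /eqP/mnmP e; apply/eqP/mnmP => t.
  by have := e t; have := ew1 t; have := ew2 t; rewrite !mnmDE; lia.
move=> _ [a ma <-] k u /=; rewrite coefC; case: eqP => [->|_]; last by rewrite msupp0.
move=> au; exists 0%MM; rewrite ?mdeg0 // expo0 /mnm_lt.
apply/andP; split; first by apply/mnm_lepP => t; rewrite mnm0E.
apply: contraTneq au => <-; rewrite mcoeff_msupp negbK; apply/eqP.
apply: (@ideal_gen_min _ _ [set f : {mpoly K[q]} | f@_0%MM = 0] _ _ _ ma).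
  split=> /=; first by rewrite mcoeff0.
  by move=> r f1 f2; rewrite mcoeffD rmorphM /= => -> ->; rewrite mulr0 addr0.
by move=> _ [i _ <-] /=; rewrite mcoeffX mnm1_eq0.
Qed.

(** Homogeneity of the ideal, from which the grading of the Rees ring descends to the fiber cone. *)
Lemma max_ideal_rees_component (p : rees I) k : max_ideal_rees p ->
  max_ideal_rees (hrees k (rees_val p)`_k).
Proof.
have Hm := ideal_gen_ideal [set rees_const I a | a in max_ideal].
have hrees0 k' : hrees k' 0 = 0.
  apply: val_inj; rewrite /= hrees_val ?scale0r //.
  exact: (is_ideal0 (ideal_pow_ideal I k')).
move=> mp; pose S : set (rees I) := [set p | forall k, max_ideal_rees (hrees k (rees_val p)`_k)].
suff : S p by apply.
apply: (ideal_gen_min _ _ mp); first split.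
- by move=> k'; rewrite /= coef0 hrees0; exact: (is_ideal0 Hm).
- move=> a f1 f2 H1 H2 k'; rewrite /= coefD hreesD; [|exact: (rees_coef (a * f1))|exact: rees_coef].
  apply: (is_idealD Hm); last exact: H2.
  have -> : hrees k' (rees_val a * rees_val f1)`_k' =
      \sum_(i < k'.+1) hrees i (rees_val a)`_i * hrees (k' - i) (rees_val f1)`_(k' - i).
    apply: val_inj; rewrite /= hrees_val; last exact: (rees_coef (a * f1)).
    rewrite -[RHS]/(val _) rmorph_sum coefM scaler_suml; apply: eq_bigr => i _.
    rewrite rmorphM /= !hrees_val; try exact: rees_coef.
    by rewrite -scalerAl -scalerAr scalerA -exprD subnKC // -ltnS.
  by apply: (is_ideal_sum _ Hm) => i; apply: (is_idealMl _ Hm); exact: H1.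
move=> _ [a ma <-] k'; rewrite /= coefC; case: eqP => [->|_].
  have -> : hrees 0 a = rees_const I a.
    by apply: val_inj; rewrite /= hrees_val // -mul_polyC mulr1.
  by apply: sub_ideal_gen; exists a.
by rewrite hrees0; exact: (is_ideal0 Hm).
Qed.

Lemma homogeneous_hrees (p : rees I) k : (forall i, i <> k -> (rees_val p)`_i = 0) ->
  p = hrees k (rees_val p)`_k.
Proof.
move=> p0; apply: val_inj; rewrite /= hrees_val; last exact: rees_coef.
apply/polyP => i; rewrite coefZ coefXn; case: eqP => [->|/p0 ->]; by rewrite ?mulr1 ?mulr0.
Qed.

Lemma hrees_homogeneous k f i : ideal_pow I k f -> i <> k -> (rees_val (hrees k f))`_i = 0.
Proof. by move=> If /eqP/negbTE ik; rewrite hrees_val // coefZ coefXn ik mulr0. Qed.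

Lemma fiber_degree_hrees k a : fiber_degree I k a <->
  exists2 f, ideal_pow I k f & a = pi (hrees k f).
Proof.
split=> [[p /= /homogeneous_hrees -> <-]|[f If ->]].
  by eexists; [exact: rees_coef|].
by exists (hrees k f) => // i ik; exact: hrees_homogeneous.
Qed.

Lemma fiber_graded : graded_algebra (fiber_const I) (fiber_degree I).
Proof.
split.
- apply/seteqP; split=> [a /fiber_degree_hrees[f _ ->]|_ [a _ <-]].
    exists f@_0%MM => //; rewrite -fiber_const_rees; congr (pi _).
    by apply: val_inj; rewrite /= hrees_val // -mul_polyC mulr1.
  exists (rees_const I a%:MP) => // -[|i] //= _; by rewrite coefC.
- move=> k; split.
    by exists 0; rewrite ?[LHS](rmorph0 pi) // => i _ /=; rewrite coef0.
  move=> _ _ [p p0 <-] [p' p0' <-]; exists (p - p'); last exact: (rmorphB pi).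
  by move=> i ik; rewrite /= coefB p0 // p0' // subrr.
- move=> i k a b /fiber_degree_hrees[f If ->] /fiber_degree_hrees[g Ig ->].
  exists (hrees i f * hrees k g); last exact: (rmorphM pi).
  move=> t tik; rewrite /= !hrees_val // -scalerAl -scalerAr -exprD !coefZ coefXn.
  by move/eqP/negbTE: tik => ->; rewrite !mulr0.
- move=> a; have [p ->] : exists p, a = pi p.
    by exists (generic_quotient.repr a); rewrite /pi /= /rees_to_fiber generic_quotient.reprK.
  exists (size (rees_val p)), (fun k => pi (hrees k (rees_val p)`_k)); split.
    by move=> k; apply/fiber_degree_hrees; eexists; [exact: rees_coef|].
  rewrite -rmorph_sum; congr (pi _); apply: val_inj.
  rewrite /= -[RHS]/(val _) rmorph_sum /= -[LHS]coefK poly_def.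
  by apply: eq_bigr => k _; rewrite hrees_val //; exact: rees_coef.
(* Directness: a vanishing sum lifts to an element of [max_ideal_rees], which contains the
   components of that element. *)
- move=> n f fk; have /choice[p Hp] k : exists p : {mpoly K[q]},
      ideal_pow I k p /\ f k = pi (hrees k p).
    by have /fiber_degree_hrees[p Ip ->] := fk k; exists p.
  under eq_bigr => k _ do rewrite (Hp k).2.
  rewrite -rmorph_sum => /rees_to_fiber_eq0 => /max_ideal_rees_component comp k ltk.
  rewrite (Hp k).2; apply/rees_to_fiber_eq0.
  have := comp k; rewrite -[rees_val _]/(val _) rmorph_sum coef_sum (bigD1 (Ordinal ltk)) //=.
  rewrite big1 ?addr0 => [|i ik].
    by rewrite hrees_val ?coefZ ?coefXn ?eqxx ?mulr1 //; exact: (Hp k).1.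
  apply: hrees_homogeneous; first exact: (Hp i).1.
  by apply/eqP; rewrite eq_sym; apply: contra ik => /eqP e; apply/eqP/val_inj.
Qed.

Lemma z_degree1 i : fiber_degree I 1%N (z i).
Proof. by apply/fiber_degree_hrees; exists 'X_[c i]; first exact: (ideal_pow1 (I_c i)). Qed.

Lemma fiber_standard_graded : standard_graded (fiber_const I) (fiber_degree I).
Proof.
split; first exact: fiber_graded.
exists m, z; split; first exact: z_degree1.
by move=> a; have [g <-] := psi_surj a; exists g.
Qed.

Lemma irrelevant_ideal_sub (J : set A) : is_ideal J -> (forall i, J (z i)) ->
  irrelevant_ideal (fiber_degree I) `<=` J.
Proof.
move=> HJ Jz; apply: ideal_gen_min => // a [[//|k] _ /fiber_degree_hrees[f If ->]].
apply: (hrees_ind (P := J)) If => [|r u v|u i _].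
- exact: is_ideal0.
- by move=> Ju Jv; apply: is_idealD => //; exact: is_idealMl.
- exact: is_idealMl.
Qed.

(** The evident lift of [psi g] to the Rees ring lies in [max_ideal_rees]. The given sum is its
    coefficient at t^(deg w) and the monomial with exponent [expo c w]. *)
Lemma psi_kernel_coef g (w : 'X_{1..m}) : psi g = 0 ->
  \sum_(v <- msupp g | (mdeg v == mdeg w) && (expo c v == expo c w)) g@_v != 0 ->
  exists2 w' : 'X_{1..m}, mdeg w' = mdeg w & mnm_lt (expo c w') (expo c w).
Proof.
move=> g0 gw; pose r v := rees_const I (g@_v)%:MP * hrees (mdeg v) 'X_[expo c v].
have /rees_to_fiber_eq0 /max_ideal_rees_dominated/(_ (mdeg w) (expo c w)) :
    pi (\sum_(v <- msupp g) r v) = 0.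
  rewrite -g0 rmorph_sum {2}(mpolyE g) rmorph_sum; apply: eq_bigr => v _.
  rewrite psiZ (ideal_pow_expo v).2 rmorphM fiber_const_rees.
  by rewrite mcoeffC eqxx mulr1.
apply; rewrite -[rees_val _]/(val _) rmorph_sum coef_sum mcoeff_msupp raddf_sum /=.
move: gw; congr (_ != 0); rewrite big_mkcond; apply: eq_bigr => v _.
rewrite coefCM hrees_val; last exact: (ideal_pow_expo v).1.
rewrite coefZ coefXn eq_sym.
case: eqP => _; last by rewrite mulr0 mulr0 mcoeff0.
by rewrite mulr1 mcoeffCM mcoeffX; case: eqP => _; rewrite ?mulr1 ?mulr0.
Qed.

(** The image of [u] is that of [v] times a nonconstant monomial, which acts as 0 on the fiber
    cone. *)
Lemma psi_dominated u v : mdeg v = mdeg u -> mnm_lt (expo c v) (expo c u) -> psi 'X_[u] = 0.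
Proof.
move=> duv /andP[levu nevu]; rewrite (ideal_pow_expo u).2 -(submK levu) mpolyXD -duv.
rewrite hreesM; last exact: (ideal_pow_expo v).1.
rewrite rmorphM fiber_const_rees mcoeffX.
case: eqP => [e|_]; last by rewrite rmorph0 mul0r.
by case/eqP: nevu; rewrite -(submK levu) e add0m.
Qed.

Lemma psi_expo_eq u v : mdeg v = mdeg u -> expo c v = expo c u -> psi 'X_[v] = psi 'X_[u].
Proof. by move=> duv euv; rewrite !(ideal_pow_expo _).2 duv euv. Qed.

Lemma fiber_noetherian : @noetherian A.
Proof. exact: (noetherian_surj psi_surj (@mpoly_noetherian K m)). Qed.

End FiberCone.

(** * Fiber cones of concave ideals *)

Section ConcaveFiberCone.
Context (K : fieldType) (n : nat) (I : set {mpoly K[2]}) (c : 'I_n.+2 -> 'X_{1..2}).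
Hypothesis I_gen : I = ideal_gen [set 'X_[u] | u in range c].
Hypothesis c_xdecr : forall i i' : 'I_n.+2, (i < i')%N -> (c i' ord0 < c i ord0)%N.
Hypothesis c_yincr : forall i i' : 'I_n.+2, (i < i')%N -> (c i ord_max < c i' ord_max)%N.
Hypothesis c_first : c ord0 ord_max = 0%N.
Hypothesis c_last : c ord_max ord0 = 0%N.
Hypothesis c_concave : concave c.
Context (l : nat) (j : 'I_l -> 'I_n.+2).
Hypothesis j_incr : forall k k' : 'I_l, (k < k')%N -> (j k < j k')%N.
Hypothesis j_corner : range j = [set i | corner c i].

Let A := fiber_cone I.
Let z i : A := rees_to_fiber (rees_deg1 I 'X_[c i]).
Let psi : {rmorphism {mpoly K[n.+2]} -> A} := mmap (fiber_const I) z.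
Let L := fiber_relations I c.
Let B : set {mpoly K[n.+2]} := binomial_relations j.
Let M := monomial_relations B.
Let L0 := ideal_gen (B `|` M).

Lemma fiber_relations_ideal : is_ideal L.
Proof.
split; first exact: (rmorph0 psi).
move=> a u v Lu Lv; rewrite /L /fiber_relations /mkset -[LHS]/(psi _) rmorphD rmorphM.
by rewrite [psi u]Lu [psi v]Lv mulr0 addr0.
Qed.

Lemma std_antichain (v w : 'X_{1..n.+2}) : std v -> std w -> mdeg v = mdeg w ->
  (expo c v <= expo c w)%MM -> v = w.
Proof.
move=> /std_smon[a [b [i ->]]] /std_smon[a' [b' [i' ->]]] d le.
by have [-> -> ->] := smon_antichain c_xdecr c_yincr c_first c_last d le.
Qed.

Lemma smon_inj a b i a' b' i' : smon a b i = smon a' b' i' :> 'X_{1..n.+2} ->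
  [/\ a = a', b = b' & i = i'].
Proof.
move=> e; apply: (smon_antichain c_xdecr c_yincr c_first c_last); rewrite e //.
exact: lepm_refl.
Qed.

(** By the antichain property no cancellation occurs at a monomial [w] of [g], so some [w'] of the
    same degree has a strictly smaller exponent. Reducing [w'] to a standard monomial [w''] gives
    [w'' = w] by the antichain property again, a contradiction. *)
Lemma fiber_relations_std g : L g -> (forall v, v \in msupp g -> std v) -> g = 0.
Proof.
move=> Lg gstd; apply: contrapT => g0.
have [w gw] : exists w, w \in msupp g.
  apply: contrapT => nex; apply: g0; apply/mpolyP => u; rewrite mcoeff0.
  by apply: contrapT => gu; apply: nex; exists u; rewrite mcoeff_msupp; apply/eqP.
have [|w' dw' /andP[lew' new']] := psi_kernel_coef I_gen (w := w) Lg.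
  rewrite big_mkcond (bigD1_seq w) ?msupp_uniq //= !eqxx /= big_seq_cond big1 ?addr0.
    by rewrite -mcoeff_msupp.
  move=> v /andP[gv vw]; case: ifP => // /andP[/eqP dv /eqP ev]; case/eqP: vw.
  by apply: std_antichain; rewrite ?ev ?lepm_refl //; exact: gstd.
have [w'' [sw'' dw'' le'' _]] := @reduction K n c c_concave l j j_incr j_corner w'.
have ew : w'' = w.
  apply: std_antichain => //; [exact: gstd|by rewrite dw''|exact: lepm_trans le'' lew'].
case/eqP: new'; rewrite -ew; apply/mnmP => t; apply/eqP; rewrite eqn_leq.
rewrite ew in le'' *.
by move/mnm_lepP/(_ t): le'' ->; move/mnm_lepP/(_ t): lew' ->.
Qed.

Lemma binomial_relations_sub : B `<=` L.
Proof.
move=> f /(binomial_relationsE j_incr j_corner)[h [i [i' [h' [ex nc ->]]]]].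
apply/eqP; rewrite -[X in X == _]/(psi _) -!mpolyXD rmorphB subr_eq0; apply/eqP.
apply: (psi_expo_eq I_gen); first by rewrite !mdegD !mdeg1.
by rewrite !expoD !expoU; exact: exchange_eq.
Qed.

Lemma monomial_relations_sub : M `<=` L.
Proof.
move=> f /(monomial_relationsE j_incr j_corner)[h [i [i' [h' [k [ex hk ck ->]]]]]].
rewrite -mpolyXD; apply: (psi_dominated I_gen (v := (U_(h) + U_(h'))%MM)).
  by rewrite !mdegD !mdeg1.
by rewrite !expoD !expoU; exact: exchange_lt ck.
Qed.

Lemma fiber_relationsE : L0 = L.
Proof.
exact: (relations_eq c_concave j_incr j_corner fiber_relations_ideal
  fiber_relations_std binomial_relations_sub monomial_relations_sub).
Qed.

Lemma initial_fiber_relations :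
  initial_ideal grevlex_lt L0 = ideal_pow (@inner_variables_ideal K n.+2) 2.
Proof.
exact: (initial_ideal_L0 c_concave j_incr j_corner fiber_relations_ideal
  fiber_relations_std binomial_relations_sub monomial_relations_sub).
Qed.

Let s : A := z ord0.
Let t : A := z ord_max.
Let e (i : 'I_n.+1) : A := psi 'X_[emon i].

Lemma psi_smon a b i : psi 'X_[smon a b i] = s ^+ a * t ^+ b * e i.
Proof.
rewrite /smon !mpolyXD -!mpolyXn !rmorphM !rmorphXn /= !mmapX !mmap1U.
by rewrite mulrAC /e /psi /= mmapX.
Qed.

Lemma psi_normal_form v : psi 'X_[v] = 0 \/
  exists a b i, mdeg v = (a + (i != ord0) + b)%N /\ psi 'X_[v] = s ^+ a * t ^+ b * e i.
Proof.
have [rho [Lrho Hrho]] := normal_form K c_concave j_incr j_corner v.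
have -> : psi 'X_[v] = psi rho.
  apply/eqP; rewrite -subr_eq0 -rmorphB; apply/eqP.
  by rewrite -/L0 fiber_relationsE in Lrho.
case: Hrho => [->|[v' [/std_smon[a [b [i ->]]] dv -> _]]]; first by left; rewrite rmorph0.
by right; exists a, b, i; rewrite -dv mdeg_smon psi_smon.
Qed.

Let V (N : nat) : set A := [set a |
  exists2 g, forall v, v \in msupp g -> (mdeg v <= N)%N & psi g = a].

Lemma fiber_growth N a : V N a -> exists lam : 'I_N.+1 * 'I_N.+1 * 'I_n.+1 -> K,
  a = \sum_x fiber_const I (lam x) * (s ^+ x.1.1 * t ^+ x.1.2 * e x.2).
Proof.
case=> g sg <-; rewrite (mpolyE g) rmorph_sum big_seq.
apply: (big_ind (fun a => exists lam : 'I_N.+1 * 'I_N.+1 * 'I_n.+1 -> K,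
  a = \sum_x fiber_const I (lam x) * (s ^+ x.1.1 * t ^+ x.1.2 * e x.2))).
- by exists (fun=> 0); rewrite big1 // => x _; rewrite rmorph0 mul0r.
- move=> _ _ [f ->] [f' ->]; exists (fun x => f x + f' x); rewrite -big_split.
  by apply: eq_bigr => x _; rewrite rmorphD mulrDl.
move=> v gv; rewrite -mul_mpolyC rmorphM [psi _%:MP]mmapC.
have [->|[p [q [i [dv ->]]]]] := psi_normal_form v.
  by exists (fun=> 0); rewrite mulr0 big1 // => x _; rewrite rmorph0 mul0r.
have dvN := sg v gv.
have ltp : (p < N.+1)%N by lia.
have ltq : (q < N.+1)%N by lia.
pose x0 := (Ordinal ltp, Ordinal ltq, i).
exists (fun x => if x == x0 then g@_v else 0).
rewrite (bigD1 x0) //= eqxx big1 ?addr0 // => x /negbTE ->.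
by rewrite !rmorph0 mul0r.
Qed.

Lemma psi_fiber_surj a : exists g, psi g = a.
Proof. exact: psi_surj. Qed.

Lemma fiber_span u : exists p : 'I_n.+1 -> {poly {poly K}},
  u = \sum_i heval (heval (fiber_const I) s) t (p i) * e i.
Proof.
have [g <-] := psi_fiber_surj u.
have [|f ->] := @fiber_growth (msize g) (psi g).
  by exists g => // v gv; rewrite ltnW // msize_mdeg_lt.
have [p ep] := poly2_span (fiber_const I) s t e (fun a b i => f (a, b, i)); exists p; rewrite {}ep.
transitivity (\sum_x \sum_i fiber_const I (f (x, i)) * (s ^+ x.1 * t ^+ x.2 * e i)).
  by rewrite pair_bigA; apply: eq_bigr => -[].
rewrite exchange_big; apply: eq_bigr => i _; rewrite exchange_big pair_bigA mulr_suml.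
by apply: eq_bigr => -[a b] _ /=; rewrite !mulrA.
Qed.

(** The [p i] encode a combination [G] of distinct standard monomials that lies in [L], hence
    vanishes. *)
Lemma fiber_free (p : 'I_n.+1 -> {poly {poly K}}) :
  \sum_i heval (heval (fiber_const I) s) t (p i) * e i = 0 -> forall i, p i = 0.
Proof.
(* A bound for both variables: [size] bounds the powers of [t] and [sizeY] those of [s]. *)
pose N := \max_i maxn (size (p i)) (sizeY (p i)).
have pN i : p i = \poly_(b < N) \poly_(a < N) (p i)`_b`_a.
  have leN : (maxn (size (p i)) (sizeY (p i)) <= N)%N by rewrite /N (bigD1 i) //= leq_maxl.
  rewrite geq_max in leN; case/andP: leN => leX leY.
  apply/polyP => b; rewrite coef_poly; case: ltnP => [_|leb]; last first.
    by rewrite nth_default // (leq_trans leX).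
  apply/polyP => a; rewrite coef_poly; case: ltnP => // lea.
  by rewrite nth_default // (leq_trans _ lea) // (leq_trans (max_size_coefXY _ _)).
pose G : {mpoly K[n.+2]} :=
  \sum_(x : 'I_n.+1 * 'I_N * 'I_N) (p x.1.1)`_x.1.2`_x.2 *: 'X_[smon x.2 x.1.2 x.1.1].
have -> : \sum_i heval (heval (fiber_const I) s) t (p i) * e i = psi G.
  rewrite rmorph_sum; transitivity (\sum_i \sum_(b < N) \sum_(a < N)
      psi ((p i)`_b`_a *: 'X_[smon a b i])); last first.
    by rewrite !pair_bigA; apply: eq_bigr => -[[]].
  apply: eq_bigr => i _; rewrite {1}pN heval_poly mulr_suml; apply: eq_bigr => b _.
  rewrite heval_poly !mulr_suml; apply: eq_bigr => a _.
  by rewrite -mul_mpolyC rmorphM psi_smon [psi _%:MP]mmapC !mulrA.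
move=> /fiber_relations_std G0 i; rewrite pN.
have {}G0 : G = 0.
  apply: G0 => v; rewrite mcoeff_msupp raddf_sum /=; apply: contraNT => nsv.
  rewrite big1 // => x _; rewrite mcoeffZ mcoeffX; case: eqP => [ev|_]; last by rewrite mulr0.
  by case/negP: nsv; rewrite -ev; exact: smon_std.
apply/polyP => b; rewrite coef_poly coef0; case: ltnP => // ltb.
apply/polyP => a; rewrite coef_poly coef0; case: ltnP => // lta.
have := congr1 (mcoeff (smon a b i)) G0; rewrite mcoeff0 raddf_sum /=.
rewrite (bigD1 (i, Ordinal ltb, Ordinal lta)) //= mcoeffZ mcoeffX eqxx mulr1.
rewrite big1 ?addr0 // => -[[i' b'] a'] /= ne; rewrite mcoeffZ mcoeffX.
case: eqP => [/smon_inj[ea eb ei]|_]; last by rewrite mulr0.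
case/eqP: ne; rewrite ei; congr (_, _, _); exact: val_inj.
Qed.

Lemma fiber_cohen_macaulay : cohen_macaulay A.
Proof.
apply: (@finite_free_cohen_macaulay K A (fiber_const I) s t n.+1 e ord0 V).
- exact: fiber_noetherian I_gen.
- by move=> N N' leN a [g sg <-]; exists g => // v /sg le; exact: leq_trans leN.
- exists 1; last by rewrite rmorph1.
  by move=> v; rewrite msupp1 inE => /eqP ->; rewrite mdeg0.
- move=> i k a b [g sg <-] [g' sg' <-]; exists (g * g'); last by rewrite rmorphM.
  move=> v /msuppM_le/allpairsP[[v1 v2] /= [/sg le1 /sg' le2 ->]].
  by rewrite mdegD leq_add.
- move=> a; have [g <-] := psi_fiber_surj a; exists (msize g), g => // v gv.
  by rewrite ltnW // msize_mdeg_lt.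
- exact: fiber_growth.
- by rewrite /e /emon eqxx mpolyX0 rmorph1.
- exact: fiber_free.
Qed.

(** The order s, t, then the inner variables; position [k >= 2] holds the inner variable of index
    [k - 1]. *)
Definition yindex (k : nat) : 'I_n.+2 :=
  if k == 0%N then ord0 else if k == 1%N then ord_max else inord k.-1.

Let y k : A := z (yindex k).

Lemma yindex_inj k k' : (k < n.+2)%N -> (k' < n.+2)%N -> yindex k = yindex k' -> k = k'.
Proof.
move=> ltk ltk' /(congr1 (@nat_of_ord _)); rewrite /yindex.
by case: k ltk => [|[|k]] ltk; case: k' ltk' => [|[|k']] ltk' //=; rewrite ?inordK; lia.
Qed.

Lemma yindex_surj i : exists2 k, (k < n.+2)%N & yindex k = i.
Proof.
have [i0|i0] := eqVneq i ord0; first by exists 0%N; rewrite // /yindex /= i0.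
have [im|im] := eqVneq i ord_max; first by exists 1%N; rewrite // /yindex /= im.
rewrite -val_eqE /= -lt0n in i0; rewrite -val_eqE /= in im; have lti := ltn_ord i.
exists i.+1; first by lia.
by rewrite /yindex /= eqSS eqn0Ngt i0 /= inord_val.
Qed.

Lemma yindex_inner k : (1 < k < n.+2)%N -> inner (yindex k).
Proof.
by case: k => [|[|k]] // ltk; rewrite /inner /yindex /= inordK //=; lia.
Qed.

Lemma flag_sub k (J : set A) : is_ideal J -> (forall k', (k' < k)%N -> J (y k')) ->
  flag y k `<=` J.
Proof.
move=> HJ; elim: k => [|k IHk] Jy a; first by move=> /= ->; exact: is_ideal0.
move=> [b [d [Fb ->]]]; apply: (is_idealD HJ).
  by apply: IHk Fb => k' ltk'; apply: Jy; exact: ltnW.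
by apply: (is_idealMl _ HJ); exact: Jy.
Qed.

Lemma flag_z i : flag y n.+2 (z i).
Proof. by have [k ltk <-] := yindex_surj i; exact: flag_y. Qed.

Lemma flag_psi (f : {mpoly K[n.+2]}) : f@_0%MM = 0 -> flag y n.+2 (psi f).
Proof.
move=> /max_ideal_coef0 mf; have HF := flag_ideal y n.+2.
apply: (@ideal_gen_min _ _ [set f | flag y n.+2 (psi f)] _ _ _ mf).
  split=> /=; first by rewrite rmorph0; exact: (is_ideal0 HF).
  by move=> a u v; rewrite rmorphD rmorphM; case: HF => _; apply.
by move=> _ [i _ <-] /=; rewrite mmapX mmap1U; exact: flag_z.
Qed.

Lemma flag2_smon a b i : (0 < a + b)%N -> flag y 2 (s ^+ a * t ^+ b * e i).
Proof.
have HF := flag_ideal y 2; case: a => [|a] => [|_].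
  case: b => // b _; rewrite exprSr mulrA mulrAC mulrC; apply: (is_idealMr _ HF).
  exact: (@flag_y _ y 1 2).
rewrite exprSr -!mulrA mulrCA; apply: (is_idealMr _ HF).
exact: (@flag_y _ y 0 2).
Qed.

(** The normal form of a product of two inner variables is 0 or has degree 2 with at most one inner
    variable, so it contains [s] or [t]. *)
Lemma flag2_inner i a : inner i -> flag y n.+2 a -> flag y 2 (a * z i).
Proof.
move=> ini; have HF := flag_ideal y 2.
apply: (@flag_sub n.+2 [set a | flag y 2 (a * z i)]).
  split=> /=; first by rewrite mul0r; exact: (is_ideal0 HF).
  by move=> r u v; rewrite mulrDl -mulrA; case: HF => _; apply.
move=> k ltk /=; have [ltk2|lek2] := ltnP k 2.
  by apply: (is_idealMr _ HF); exact: flag_y.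
have -> : y k * z i = psi 'X_[U_(yindex k) + U_(i)].
  by rewrite mpolyXD rmorphM /= !mmapX !mmap1U.
have [->|[p [q [i' [d ->]]]]] := psi_normal_form (U_(yindex k) + U_(i))%MM.
  exact: (is_ideal0 HF).
apply: flag2_smon; move: d; rewrite mdegD !mdeg1; case: (i' != ord0); lia.
Qed.

(** The generators of [L0] are quadratic. *)
Lemma L0_coef f v : L0 f -> (mdeg v <= 1)%N -> f@_v = 0.
Proof.
move=> Lf; pose S := [set f : {mpoly K[n.+2]} | forall v, (mdeg v <= 1)%N -> f@_v = 0].
suff : S f by apply.
apply: (ideal_gen_min _ _ Lf); first split.
- by move=> w _; rewrite mcoeff0.
- move=> a f1 f2 H1 H2 w dw; rewrite mcoeffD H2 // addr0 mcoeffM big1 // => k /eqP ew.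
  rewrite H1 ?mulr0 //; have := congr1 (@mdeg n.+2) ew; rewrite mdegD => dE.
  by apply: leq_trans dw; have := leq_addl (mdeg k.1) (mdeg k.2); rewrite -dE.
have X2 i i' (w : 'X_{1..n.+2}) : (mdeg w <= 1)%N -> ('X_i * 'X_i' : {mpoly K[n.+2]})@_w = 0.
  move=> dw; rewrite -mpolyXD mcoeffX; case: eqP => // ew.
  by move: dw; rewrite -ew mdegD !mdeg1.
move=> g [/(binomial_relationsE j_incr j_corner)|/(monomial_relationsE j_incr j_corner)].
  by move=> [h [i [i' [h' [_ _ ->]]]]] w dw; rewrite mcoeffB !X2 // subrr.
by move=> [h [i [i' [h' [k [_ _ _ ->]]]]]] w dw; exact: X2.
Qed.

(** A combination of the first [k] variables has a lift whose linear terms involve these variables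
    only. With [L0_coef] this separates [y k] from [flag y k]. *)
Lemma flag_lift k a : (k <= n.+2)%N -> flag y k a -> exists2 g, psi g = a &
  forall k', (k <= k' < n.+2)%N -> g@_U_(yindex k')%MM = 0.
Proof.
elim: k a => [|k IHk] a lek.
  by move=> /= ->; exists 0; rewrite ?rmorph0 // => k' _; rewrite mcoeff0.
move=> [b [d [/(IHk _ (ltnW lek))[g <- g0] ->]]]; have [f <-] := psi_fiber_surj d.
exists (g + f * 'X_(yindex k)).
  by rewrite rmorphD rmorphM /= mmapX mmap1U.
move=> k' /andP[ltk ltk']; rewrite mcoeffD g0 ?add0r; last by rewrite ltnW.
apply: memN_msupp_eq0; rewrite (perm_mem (msuppMX _ _)).
apply/mapP => -[v _ /(congr1 (fun u : 'X_{1..n.+2} => u (yindex k)))].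
rewrite mnmDE !mnm1E eqxx; case: eqP => // /yindex_inj e'.
by have := e' ltk' lek; lia.
Qed.

(** [n.+2] designates the ideal generated by all the variables. *)
Let sigma k := if (k < 2)%N then k else n.+2.

(** For [k < 2] this is freeness over K[s, t]. For an inner variable the colon ideal contains all
    variables by [flag2_inner], and it is proper because [y k] is not in [flag y k]. *)
Lemma fiber_colon k : (k < n.+2)%N -> forall a, flag y k (a * y k) <-> flag y (sigma k) a.
Proof.
have X0 : ('X : {poly K}) != 0 by rewrite polyX_eq0.
move=> ltk a; case: k ltk => [|[|k]] ltk.
- rewrite /sigma /=; split=> [|->]; last by rewrite mul0r.
  rewrite mulrC => h; apply: (free_regular1 fiber_span fiber_free X0).
  by rewrite hevalX.
- rewrite /sigma /=; split; last first.
    move=> [b [d [-> ->]]]; exists 0, (d * y 1); split=> //; ring.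
  move=> [b [d [-> ed]]].
  have [|r ->] := free_regular2 (f := 'X) (a := a) (b := d) fiber_span fiber_free X0.
    by rewrite !hevalX mulrC ed add0r.
  by exists 0, r; rewrite hevalX add0r.
have ink : inner (yindex k.+2) by exact: yindex_inner.
have HF := flag_ideal y k.+2.
rewrite /sigma /=; split; last first.
  by move=> Fa; apply: (@flag_mon _ y 2 k.+2) => //; exact: flag2_inner.
have [g <-] := psi_fiber_surj a.
have [g0 _|g0 Fgy] := eqVneq g@_0%MM 0; first exact: flag_psi.
have Fc : flag y n.+2 (psi (g - (g@_0%MM)%:MP)).
  by apply: flag_psi; rewrite mcoeffB mcoeffC eqxx mulr1 subrr.
have {}Fc := @flag_mon _ y 2 k.+2 isT _ (flag2_inner ink Fc).
(* Subtracting the part of [a] without constant term leaves a nonzero scalar multiple of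
   [y k.+2]. *)
have {Fc} Fy : flag y k.+2 (y k.+2).
  have := is_idealMl (fiber_const I (g@_0%MM)^-1) HF (is_idealB HF Fgy Fc).
  rewrite -mulrBl rmorphB subKr [psi _%:MP]mmapC mulrA -rmorphM mulVf // rmorph1.
  by rewrite mul1r.
have [f fy /(_ k.+2) f0] := flag_lift (ltnW ltk) Fy.
have : L0 ('X_(yindex k.+2) - f).
  rewrite fiber_relationsE; apply/eqP; rewrite -[X in X == _]/(psi _) rmorphB fy.
  by rewrite [psi _]mmapX mmap1U subrr.
move=> /(@L0_coef _ U_(yindex k.+2)%MM); rewrite mdeg1 mcoeffB f0 ?leqnn ?ltk //.
by rewrite mcoeffX eqxx subr0 => /(_ isT)/eqP; rewrite oner_eq0.
Qed.

Lemma fiber_koszul : koszul (fiber_const I) (fiber_degree I).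
Proof.
split; first exact: (fiber_standard_graded I_gen).
apply: (koszul_of_flag (fiber_graded I) (m := n.+2) (y := y) (sigma := sigma)).
- by move=> k _; exact: (z_degree1 I_gen).
- by move=> k ltk; rewrite /sigma; case: ifP => // _; exact: ltnW.
- exact: fiber_colon.
apply/seteqP; split.
  apply: (irrelevant_ideal_sub I_gen); first exact: flag_ideal.
  exact: flag_z.
apply: flag_sub; first exact: ideal_gen_ideal.
by move=> k _; apply: sub_ideal_gen; exists 1%N => //; exact: (z_degree1 I_gen).
Qed.

End ConcaveFiberCone.

(** * Monomial ideals of height two in two variables *)

Section HeightTwo.
Context (K : fieldType) (n : nat) (i : 'I_n).

Let zero_var : {rmorphism {mpoly K[n]} -> {mpoly K[n]}} :=
  mmap (@mpolyC n K) (fun k => if k == i then 0 else 'X_k).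

Lemma zero_varX (u : 'X_{1..n}) : zero_var 'X_[u] = if u i == 0%N then 'X_[u] else 0.
Proof.
rewrite /zero_var /= mmapX /mmap1 (bigD1 i) //= eqxx.
case: eqP => [ui|/eqP ui]; last by rewrite expr0n (negbTE ui) mul0r.
rewrite ui expr0 mul1r [RHS]mpolyXE_id [RHS](bigD1 i) //= ui expr0 mul1r.
by apply: eq_bigr => k /negbTE ->.
Qed.

Lemma zero_var_dvd f : exists g, f - zero_var f = 'X_i * g.
Proof.
pose J : set {mpoly K[n]} := [set f | exists g, f = 'X_i * g].
have HJ : is_ideal J.
  split; first by exists 0; rewrite mulr0.
  by move=> a _ _ [g ->] [g' ->]; exists (a * g + g'); ring.
suff : J (f - zero_var f) by [].
rewrite {1 2}(mpolyE f) rmorph_sum -sumrB; apply: (is_ideal_sum _ HJ) => u.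
rewrite -mul_mpolyC rmorphM [zero_var _%:MP]mmapC -mulrBr; apply: (is_idealMl _ HJ).
rewrite zero_varX; case: eqP => [_|/eqP ui]; first by rewrite subrr; exact: (is_ideal0 HJ).
rewrite subr0 -lep1mP in ui *.
by rewrite -(submK ui) mpolyXD mulrC; exists 'X_[u - U_(i)].
Qed.

(* A nonzero prime properly contained in ('X_i) would be closed under division
   by 'X_i. *)
Lemma height2_not_sub_var (I : set {mpoly K[n]}) :
  height I 2 -> ~ I `<=` [set f | zero_var f = 0].
Proof.
move=> [hI _] IP; set P := [set f | _] in IP.
have P_dvd f : P f -> exists g, f = 'X_i * g.
  by move=> Pf; have [g] := zero_var_dvd f; rewrite [zero_var f]Pf subr0; exists g.
have PXi : P 'X_i by rewrite /P /= -/zero_var zero_varX mnm1E eqxx.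
have pP : prime_ideal P.
  split.
  - split; first exact: rmorph0.
    move=> a u v Pu Pv; rewrite /P /mkset rmorphD rmorphM.
    by rewrite [zero_var u]Pu [zero_var v]Pv mulr0 addr0.
  - by rewrite /P /mkset rmorph1; apply/eqP; exact: oner_neq0.
  - move=> a b; rewrite /P /mkset rmorphM => /eqP; rewrite mulf_eq0.
    by move=> /orP[] /eqP; [left|right].
have [Q [pQ subQ eQ]] := hI P pP IP.
have [Q1P nPQ1] : Q 1%N `<` P by rewrite -eQ; exact: subQ.
have [HQ1 _ Q1M] := pQ 1%N isT.
have Q1Xi : ~ Q 1%N 'X_i.
  move=> QX; apply: nPQ1 => f /P_dvd[g ->]; rewrite mulrC.
  exact: is_idealMl.
have Q10 N f : (msize f <= N)%N -> Q 1%N f -> f = 0.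
  elim: N f => [|N IHN] f sf Qf.
    by apply/eqP; rewrite -(msize_poly_eq0 f) -leqn0.
  have [g ef] := P_dvd f (Q1P f Qf); have [//|f0] := eqVneq f 0.
  have g0 : g != 0 by apply: contraNneq f0 => g0; rewrite ef g0 mulr0.
  have X0 : 'X_i != 0 :> {mpoly K[n]} by rewrite -(msize_poly_eq0 'X_i) msizeX.
  rewrite ef (IHN g) ?mulr0 //.
    by move: sf; rewrite ef msizeM // msizeX mdeg1.
  by move: Qf; rewrite ef => /Q1M[].
have [_ nQ] := subQ 0%N isT; apply: nQ => f Qf.
by rewrite (Q10 (msize f) f) //; have [[Q00 _] _ _] := pQ 0%N isT.
Qed.

(** Otherwise ['X_i] divides all generators, and the ideal lies in the kernel of [zero_var]. *)
Lemma height2_generator_avoids_var (I : set {mpoly K[n]}) (m : nat)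
    (c : 'I_m -> 'X_{1..n}) :
  I = ideal_gen [set 'X_[u] | u in range c] -> height I 2 ->
  exists k, c k i = 0%N.
Proof.
move=> I_gen /height2_not_sub_var nsub; apply: contrapT => nex; apply: nsub.
rewrite I_gen; apply: ideal_gen_min.
  split; first exact: rmorph0.
  move=> a u v; rewrite /mkset rmorphD rmorphM => -> ->.
  by rewrite mulr0 addr0.
move=> _ [_ [k _ <-] <-]; rewrite /mkset zero_varX.
by case: eqP => // ck; case: nex; exists k.
Qed.

End HeightTwo.

(** * The staircase of minimal generators *)

Section MinimalGenerators.
Context (K : fieldType) (I : set {mpoly K[2]}) (m : nat) (c : 'I_m -> 'X_{1..2}).
Hypothesis I_height : height I 2.
Hypothesis I_gens : minimal_monomial_generators I (range c).
Hypothesis c_lex : forall i i' : 'I_m, (i < i')%N -> lex_lt (c i') (c i).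

Let I_gen : I = ideal_gen [set 'X_[u] | u in range c].
Proof. by case: I_gens. Qed.

Lemma lex_lt_irr (u : 'X_{1..2}) : ~~ lex_lt u u.
Proof. by apply/existsPn => i; rewrite ltnn. Qed.

Lemma c_inj : injective c.
Proof.
move=> i i' e; apply: val_inj => /=.
by have [/c_lex|/c_lex|//] := ltngtP i i'; rewrite e (negbTE (lex_lt_irr _)).
Qed.

(** A generator divisible by another one could be omitted, against minimality. *)
Lemma c_antichain i i' : i <> i' -> ~ (c i <= c i')%MM.
Proof.
move=> ne le; have [_ Gmin] := I_gens; pose G' : set 'X_{1..2} := range c `\ c i'.
have G'c : G' `<=` range c by move=> u [].
have : G' = range c.
  apply: Gmin => //; apply/seteqP; split; last first.
    rewrite I_gen; apply: ideal_genS => _ [u G'u <-].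
    by exists u => //; exact: G'c.
  rewrite {1}I_gen; have HG := ideal_gen_ideal [set ('X_[u] : {mpoly K[2]}) | u in G'].
  apply: (ideal_gen_min HG) => _ [_ [k _ <-] <-].
  have G'k t : t <> i' -> ideal_gen [set ('X_[u] : {mpoly K[2]}) | u in G'] 'X_[c t].
    move=> ti; apply: sub_ideal_gen; exists (c t) => //.
    by split; [exists t|move=> /= /c_inj].
  have [->|/eqP ki] := eqVneq k i'; last exact: G'k.
  by rewrite -(submK le) mpolyXD; apply: (is_idealMl _ HG); exact: G'k.
move=> e; have : G' (c i') by rewrite e; exists i'.
by case=> _; apply.
Qed.

(** If the first coordinates agreed, the vectors would be comparable. So the first one decreases,
    and incomparability makes the second one increase. *)
Lemma c_monotone (i i' : 'I_m) : (i < i')%N ->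
  (c i' ord0 < c i ord0)%N /\ (c i ord_max < c i' ord_max)%N.
Proof.
move=> lti; have ne : i' <> i by move=> e; rewrite e ltnn in lti.
have := c_antichain ne; have /existsP[t /andP[ltt /forallP eqt]] := c_lex lti.
have ord2 (k : 'I_2) : k = ord0 \/ k = ord_max.
  by case: k => -[|[|//]] h; [left|right]; apply: val_inj.
have leP2 : (c i' ord0 <= c i ord0)%N -> (c i' ord_max <= c i ord_max)%N -> (c i' <= c i)%MM.
  by move=> h0 h1; apply/mnm_lepP => k; case: (ord2 k) => ->.
case: (ord2 t) ltt eqt => -> ltt eqt nle.
  split=> //; rewrite ltnNge; apply/negP => h; apply: nle.
  by apply: leP2 => //; exact: ltnW.
case: nle; apply: leP2; last exact: ltnW.
by have /eqP -> := eqt ord0.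
Qed.

(** The height yields a generator without x and one without y. They differ because the ideal is
    proper, and monotonicity puts them at the two ends. *)
Lemma height2_staircase : [/\ (1 < m)%N,
  forall i : 'I_m, i = 0%N :> nat -> c i ord_max = 0%N &
  forall i : 'I_m, i.+1 = m -> c i ord0 = 0%N].
Proof.
have [kx ckx] := height2_generator_avoids_var ord0 I_gen I_height.
have [ky cky] := height2_generator_avoids_var ord_max I_gen I_height.
have nek : kx <> ky.
  move=> e; have [_ [P [[_ P1 _] IP _]]] := I_height; apply: P1; apply: IP.
  rewrite I_gen; apply: sub_ideal_gen; exists (c kx); first by exists kx.
  have -> : c kx = 0%MM; last by rewrite mpolyX0.
  apply/mnmP => -[[|[|//]] h]; rewrite mnm0E.
    by transitivity (c kx ord0) => //; congr (c _ _); apply: val_inj.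
  by rewrite e; transitivity (c ky ord_max) => //; congr (c _ _); apply: val_inj.
split.
- have := ltn_ord kx; have := ltn_ord ky.
  by case: (ltngtP kx ky) => [||/val_inj//]; lia.
- move=> i i0; have [ltk|lek] := ltnP i ky.
    by have [_] := c_monotone ltk; rewrite cky.
  have -> // : i = ky by apply: val_inj; move: lek; rewrite /= i0; lia.
- move=> i im; have [ltk|lek] := ltnP kx i.
    by have [] := c_monotone ltk; rewrite ckx.
  have -> // : i = kx by apply: val_inj => /=; have := ltn_ord kx; lia.
Qed.

End MinimalGenerators.

Theorem theorem2p6 (K : fieldType) (I : set {mpoly K[2]})
    (m : nat) (c : 'I_m -> 'X_{1..2})
    (I_height : height I 2)
    (I_gens : minimal_monomial_generators I (range c))
    (c_lex : forall i i' : 'I_m, (i < i')%N -> lex_lt (c i') (c i))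
    (c_concave : concave c)
    (l : nat) (j : 'I_l -> 'I_m)
    (j_incr : forall k k' : 'I_l, (k < k')%N -> (j k < j k')%N)
    (j_corner : range j = [set i | corner c i]) :
  let L := fiber_relations I c in
  let B : set {mpoly K[m]} := binomial_relations j in
  let M := monomial_relations B in
  let L0 := ideal_gen (B `|` M) in
  [/\ B `<=` L,
      M `<=` L,
      initial_ideal grevlex_lt L0 = ideal_pow inner_variables_ideal 2,
      L0 = L
    & cohen_macaulay (fiber_cone I) /\
      koszul (fiber_const I) (fiber_degree I)].
Proof.
have [lt1m c_first c_last] := height2_staircase I_height I_gens c_lex.
have c_mono := c_monotone I_gens c_lex; have [I_gen _] := I_gens.
(* Writing the number of generators as [n.+2] makes [ord0] and [ord_max] available as first and last
   index. *)
case: m c I_gens c_lex c_concave j j_incr j_corner lt1m c_first c_last c_mono I_gen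
  => [|[|n]] // c _ _ c_concave j j_incr j_corner _ c_first c_last c_mono I_gen L B M L0.
have cx i i' lt := (c_mono i i' lt).1; have cy i i' lt := (c_mono i i' lt).2.
have c0 := c_first ord0 erefl; have cm := c_last ord_max erefl.
split.
- exact: (binomial_relations_sub I_gen c_concave j_incr j_corner).
- exact: (monomial_relations_sub I_gen c_concave j_incr j_corner).
- exact: (initial_fiber_relations I_gen cx cy c0 cm c_concave j_incr j_corner).
- exact: (fiber_relationsE I_gen cx cy c0 cm c_concave j_incr j_corner).
- split; first exact: (fiber_cohen_macaulay I_gen cx cy c0 cm c_concave j_incr j_corner).
  exact: (fiber_koszul I_gen cx cy c0 cm c_concave j_incr j_corner).
Qed.
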